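(* Let $q\in L_1^{\rm loc}(\mathbb R)$, $q\ge 0$, satisfy $$\int_{-\infty}^{0}q(t)\,dt=\int_{0}^{\infty}q(t)\,dt=\infty ,\qquad \inf_{x\in\mathbb R}\int_{x-a}^{x+a}q(t)\,dt=0\quad\text{for all } a\in(0,\infty),$$ and suppose that $q\in K(\gamma)$ for some $\gamma\le e^{-1}$. Let $\theta:\mathbb R\to(0,\infty)$ be a continuous function such that $\theta(x)\asymp q^{*}(x)$, $x\in\mathbb R$. Then for every $p\in[1,\infty)$ the pair of spaces $\{L_{p,\theta}(\mathbb R);L_p(\mathbb R)\}$ is admissible for the equation $$-y'(x)+q(x)y(x)=f(x),\quad x\in\mathbb R .$$
   Context: Solutions: a solution of $-y'+qy=f$ is an absolutely continuous function (i.e. absolutely continuous on every bounded interval) $y$ on $\mathbb R$ satisfying the equation almost everywhere on $\mathbb R$. Weighted space: for a continuous positive function $\theta$ on $\mathbb R$ and $p\in[1,\infty)$, $L_{p,\theta}(\mathbb R)=\{f\in L_p^{\rm loc}(\mathbb R):\int_{-\infty}^\infty|\theta(x)f(x)|^p\,dx<\infty\}$ with norm $\|f\|_{p,\theta}=\left(\int_{-\infty}^\infty|\theta(x)f(x)|^p\,dx\right)^{1/p}$. The norm of $L_p=L_p(\mathbb R)$ is $\|\cdot\|_p$. Admissibility: the pair $\{L_{p,\theta};L_p\}$ is admissible for the equation $-y'+qy=f$ if (i) for any $f\in L_p$ the equation has a unique solution $y\in L_{p,\theta}$; (ii) there is a constant $c(p)\in(0,\infty)$, independent of $f$, such that for every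 $f\in L_p$ the solution $y\in L_{p,\theta}$ satisfies $\|y\|_{p,\theta}\le c(p)\|f\|_p$. The functions $d$ and $q^*$: for $0\le q\in L_1^{\rm loc}(\mathbb R)$ with $\int_{-\infty}^\infty q(t)\,dt=\infty$, set $d(x)=\inf\{d\ge0:\int_{x-d}^{x+d}q(\xi)\,d\xi=2\}$ and $q^*(x)=1/d(x)$, $x\in\mathbb R$. Class $K(\gamma)$: $q\in K(\gamma)$ means that there are $a\ge1$, $b>0$, $x_0\ge1$ with $\gamma=a\exp(-b/a^2)$ such that for all $|x|\ge x_0$ one has $a^{-1}d(x)\le d(t)\le a\,d(x)$ whenever $|t-x|\le b\,d(x)$. Weak equivalence: for positive functions $\varphi,\psi$ on $\mathbb R$, $\varphi(x)\asymp\psi(x)$, $x\in\mathbb R$, means that there is a constant $c\ge1$ with $c^{-1}\varphi(x)\le\psi(x)\le c\varphi(x)$ for all $x\in\mathbb R$. *)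

(* Defs.v *)
From HB Require Import structures.
From mathcomp Require Import all_boot all_order all_algebra.
From mathcomp Require Import all_classical all_reals all_analysis.

Set Implicit Arguments.
Unset Strict Implicit.
Unset Printing Implicit Defensive.

Import Order.TTheory GRing.Theory Num.Theory.
Import numFieldNormedType.Exports.

Local Open Scope classical_set_scope.
Local Open Scope ring_scope.

Section Defs.
Context {R : realType}.
Local Notation mu := (@lebesgue_measure R).
Implicit Types (q f y theta phi psi : R -> R) (a b x p gamma : R).

Definition abs_continuous_itv a b y : Prop :=
  forall e : R, 0 < e -> exists2 delta : R, 0 < delta &
    forall (n : nat) (u v : 'I_n -> R),
      (forall i, [/\ a <= u i, u i <= v i & v i <= b]) ->
      trivIset [set: 'I_n] (fun i => `]u i, v i[%classic) ->
      \sum_(i < n) (v i - u i) < delta ->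
      \sum_(i < n) `|y (v i) - y (u i)| < e.

Definition abs_continuous_loc y : Prop :=
  forall a b, a <= b -> abs_continuous_itv a b y.

(* [derive1] is a total operator, hence the explicit [derivable]. *)
Definition is_solution q f y : Prop :=
  abs_continuous_loc y /\
  {ae mu, forall x, derivable y x 1 /\ - derive1 y x + q x * y x = f x}.

Definition Lp_loc p f : Prop :=
  measurable_fun [set: R] f /\
  forall K : set R, compact K ->
    (\int[mu]_(x in K) (`|f x| `^ p)%:E < +oo)%E.

Definition Lp_weighted p theta f : Prop :=
  Lp_loc p f /\ (\int[mu]_x (`|theta x * f x| `^ p)%:E < +oo)%E.

Definition norm_weighted p theta f : \bar R :=
  'N[mu]_(p%:E)[EFin \o (theta \* f)].

Definition admissible p theta q : Prop :=
  (forall f, f \in Lfun mu p%:E ->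
     exists! y, is_solution q f y /\ Lp_weighted p theta y) /\
  (exists2 c : R, 0 < c &
     forall f y, f \in Lfun mu p%:E ->
       is_solution q f y -> Lp_weighted p theta y ->
       (norm_weighted p theta y <= c%:E * 'N[mu]_(p%:E)[EFin \o f])%E).

(* [inf set0 = 0] by convention; the set below is nonempty as soon as q >= 0 is
   locally integrable with infinite integral over R. *)
Definition d_fun q x : R :=
  inf [set d : R | 0 <= d /\
    (\int[mu]_(t in `[(x - d)%R, (x + d)%R]) (q t)%:E)%E = (2 : R)%:E].

Definition q_star q x : R := (d_fun q x)^-1.

Definition class_K gamma q : Prop :=
  exists a b x0 : R,
    [/\ 1 <= a, 0 < b, 1 <= x0, gamma = a * expR (- (b / a ^+ 2)) &
      forall x, x0 <= `|x| -> forall t, `|t - x| <= b * d_fun q x ->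
        a^-1 * d_fun q x <= d_fun q t /\ d_fun q t <= a * d_fun q x].

Definition weakly_equivalent phi psi : Prop :=
  exists2 c : R, 1 <= c &
    forall x, c^-1 * phi x <= psi x /\ psi x <= c * phi x.

End Defs.

(* Main.v *)
(**
The solution is the Green operator [y x = exp (Q x) * \int_x^oo exp (- Q t) f t dt]
with [Q' = q], and its boundedness from L_p to L_{p,theta} is a Schur test for the
kernel [theta x * exp (Q x - Q t)], [x <= t], whose row integrals (in [t]) and column
integrals (in [x]) must be bounded uniformly.

The real line is cut into consecutive cells [m - d m, m + d m], each of q-mass 2.
Since [theta] is comparable with [1 / d m] on the cell of [m], the column integral
is dominated by a geometric series of ratio [exp (- 2)]. Since [theta] is at most
[c / d], the row integral is dominated by a geometric series whose ratio is the growth factor of [d] over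
a block of cells divided by the exponential of the q-mass of the block; the assumption
[gamma <= exp (- 1)], that is [a ^ 2 * (1 + ln a) <= b], makes this ratio smaller
than 1.

Two solutions differ by [k * exp Q], and [theta * exp Q] is bounded away from 0 on
[0, oo[ because [d x * exp (- Q x)] is at most a multiple of [\int_0^oo exp (- Q)];
so [k = 0].
*)

Require Import Defs.
From HB Require Import structures.
From mathcomp Require Import all_boot all_order all_algebra.
From mathcomp Require Import all_classical all_reals all_analysis.
From mathcomp Require Import measurable_realfun.
From mathcomp Require Import ring lra.

Import Order.TTheory GRing.Theory Num.Theory.
Import numFieldNormedType.Exports.

Local Open Scope classical_set_scope.
Local Open Scope ring_scope.

(** * Primitives, absolute continuity and vanishing derivatives *)

Section primitive.
Context {R : realType}.
Local Notation mu := (@lebesgue_measure R).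
Implicit Types (g G : R -> R).

(** The additive constant is left free, so that minus a tail integral over [[x, +oo[] also
    qualifies. *)
Definition is_primitive g G : Prop :=
  forall a b, a <= b -> \int[mu]_(t in `[a, b]) g t = G b - G a.

Lemma locally_integrable_itv g a b :
  locally_integrable [set: R] g -> mu.-integrable `[a, b] (EFin \o g).
Proof.
move=> [mg _ intg]; apply/integrableP; split.
  by apply/measurable_EFinP; exact: measurable_funS mg.
by apply: intg => //; exact: segment_compact.
Qed.

Lemma Rintegral_itv_cat g a b c :
  locally_integrable [set: R] g -> a <= b -> b <= c ->
  \int[mu]_(t in `[a, c]) g t =
  \int[mu]_(t in `[a, b]) g t + \int[mu]_(t in `[b, c]) g t.
Proof.
move=> lg ab bc.
have := @Rintegral_itvB R g (BLeft a) (BRight c) b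
  (locally_integrable_itv _ _ _ lg).
rewrite !bnd_simp => /(_ ab bc) H.
rewrite -(@Rintegral_itv_obnd_cbnd R b (BRight c)) -?H; first by ring.
apply: integrableS (locally_integrable_itv _ b c lg) => //.
exact: subset_itv_oc_cc.
Qed.

Lemma primitive_exists g : locally_integrable [set: R] g ->
  exists G, is_primitive g G.
Proof.
move=> lg.
(* At most one of the two intervals is nondegenerate: this is the signed integral from 0 to [x]. *)
exists (fun x => \int[mu]_(t in `[0, x]) g t - \int[mu]_(t in `[x, 0]) g t).
have I0 a b : b < a -> \int[mu]_(t in `[a, b]) g t = 0.
  by move=> ba; rewrite set_itv_ge ?Rintegral_set0 ?bnd_simp -?ltNge.
have I1 a : \int[mu]_(t in `[a, a]) g t = 0.
  by rewrite set_itv1 Rintegral_set1.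
move=> a b ab; case: (ltrgtP a 0) => a0; case: (ltrgtP b 0) => b0;
  rewrite ?a0 ?b0 ?I1 ?(I0 0 _ a0) ?(I0 0 _ b0) ?(I0 _ 0 a0) ?(I0 _ 0 b0) //;
  try lra.
- by rewrite (Rintegral_itv_cat _ _ _ _ lg ab (ltW b0)); lra.
- by rewrite (Rintegral_itv_cat _ _ _ _ lg (ltW a0) (ltW b0)); lra.
- by rewrite (Rintegral_itv_cat _ _ _ _ lg (ltW a0) ab); lra.
Qed.

(** Almost every [x] is a Lebesgue point, and near [x] the function [G] differs by the constant
    [G (x - 1)] from the integral started at [x - 1]. *)
Lemma primitive_derivable g G : locally_integrable [set: R] g ->
  is_primitive g G ->
  {ae mu, forall x, derivable G x 1 /\ derive1 G x = g x}.
Proof.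
move=> lg gG; have := lebesgue_differentiation lg.
apply: filterS; first exact: (ae_filter_ringOfSetsType mu).
move=> x gx.
have x1 : x < x + 1 by rewrite ltrDl.
have xx : (BLeft (x - 1)%R < BRight x)%E by rewrite lte_fin ltrBlDr ltrDl.
have [dF F'] := FTC1_lebesgue_pt x1 (locally_integrable_itv g (x - 1) (x + 1) lg) xx gx.
set F := (F in derivable F) in dF F'.
have nFG : \forall y \near x, F y + G (x - 1) = G y.
  apply/nbhs_ballP; exists 1 => //= y; rewrite /ball /= ltr_norml => /andP[y1 y2].
  by rewrite /F gG ?subrK//; lra.
have dFG : is_derive x 1 G (g x).
  apply: near_eq_is_derive nFG _.
  apply: is_derive_eq (addr0 _).
  by apply: is_deriveD; apply: DeriveDef => //; rewrite -derive1E.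
by split; [exact: ex_derive|rewrite derive1E derive_val].
Qed.

(** The increments over disjoint intervals sum to at most the integral of [|g|] over their union,
    which is small when the union has small measure. *)
Lemma primitive_abs_continuous g G : locally_integrable [set: R] g ->
  is_primitive g G -> abs_continuous_loc G.
Proof.
move=> lg gG a b ab e e0.
pose f := g \_ `[a, b].
have itf : mu.-integrable setT (EFin \o f).
  rewrite /f -restrict_EFin; apply/integrable_restrict => //=.
  by rewrite setTI; exact: locally_integrable_itv.
have [d [d0 dP]] := integral_normr_continuous itf e0.
exists d => // n u v uv tuv suv.
pose I i := `]u i, v i[%classic.
have mI i : measurable (I i) by exact: measurable_itv.
pose D := \big[setU/set0]_(i < n) I i.
have mD : measurable D by exact: bigsetU_measurable.
have muI i : mu (I i) = (v i - u i)%:E.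
  rewrite /I lebesgue_measure_itv/= lte_fin; have [_ uvi _] := uv i.
  by case: ltgtP uvi => // -> _; rewrite subrr.
have muD : (mu D < d%:E)%E.
  rewrite [mu D]measure_semi_additive_ord//.
  by rewrite (eq_bigr _ (fun i _ => muI i)) sumEFin lte_fin.
apply: le_lt_trans (dP D mD muD).
have mfD A : measurable_fun A (fun x => (`|f x|)%:E).
  apply/measurable_funTS/measurable_EFinP/measurableT_comp => //.
  by case/integrableP : itf => /measurable_EFinP.
rewrite -lee_fin /Rintegral fineK; last first.
  rewrite ge0_fin_numE; last exact: integral_ge0.
  have : mu.-integrable D (EFin \o f) by exact: integrableS itf.
  by case/integrableP.
rewrite ge0_integral_bigsetU//=; last 3 first.
- exact: index_enum_uniq.
- exact: sub_trivIset tuv.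
- exact: mfD.
rewrite -sumEFin; apply: lee_sum => i _.
have [au uvi vb] := uv i.
rewrite -gG// EFin_normr_Rintegral//; last exact: locally_integrable_itv.
apply: le_trans (le_abse_integral _ _ _) _ => //.
  by have /integrableP[] := locally_integrable_itv g (u i) (v i) lg.
rewrite integral_itv_bndoo; last first.
  apply: measurableT_comp => //; apply/measurable_EFinP.
  by case: lg => mg _ _; exact: measurable_funS mg.
rewrite le_eqVlt; apply/orP; left; apply/eqP.
apply: eq_integral => x; rewrite inE /I /= in_itv/= => /andP[ux xv].
rewrite /f patchE mem_set//= in_itv/= (le_trans au (ltW ux)).
by rewrite (le_trans (ltW xv) vb).
Qed.

End primitive.

(** * Closure properties of absolute continuity *)

Section abs_continuous.
Context {R : realType}.
Local Notation mu := (@lebesgue_measure R).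
Implicit Types (y z : R -> R) (a b : R).

Lemma abs_continuous_loc_continuous y : abs_continuous_loc y -> continuous y.
Proof.
move=> acy x; apply/cvgrPdist_lt => e e0.
have xx : x - 1 <= x + 1 by lra.
have [d d0 dP] := acy _ _ xx e e0.
apply/nbhs_ballP; exists (Num.min d 1); first by rewrite /= lt_min d0 ltr01.
move=> t; rewrite /ball /= lt_min => /andP[xtd xt1].
have H u v : x - 1 <= u -> u <= v -> v <= x + 1 -> v - u < d ->
    `|y v - y u| < e.
  move=> xu uv vx vud.
  have := dP 1%N (fun=> u) (fun=> v); rewrite !big_ord1; apply => //.
  by apply/trivIsetP => i j _ _; rewrite !ord1 eqxx.
move: xtd xt1; rewrite ![`|x - t| < _]ltr_norml => /andP[? ?] /andP[? ?].
have [xt|tx] := leP x t.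
  by rewrite distrC; apply: H; lra.
by apply: H; lra.
Qed.

(** Common source of the closure rules below for differences, products and exponentials. *)
Lemma abs_continuous_itv_dominated a b y y1 y2 (K : R) : 0 <= K ->
  (forall u v, a <= u -> u <= v -> v <= b ->
    `|y v - y u| <= K * (`|y1 v - y1 u| + `|y2 v - y2 u|)) ->
  abs_continuous_itv a b y1 -> abs_continuous_itv a b y2 ->
  abs_continuous_itv a b y.
Proof.
move=> K0 yK ac1 ac2 e e0.
have K1 : 0 < K + 1 by lra.
have eK : 0 < e / (2 * (K + 1)) by rewrite divr_gt0// mulr_gt0.
have [d1 d10 d1P] := ac1 _ eK; have [d2 d20 d2P] := ac2 _ eK.
exists (Num.min d1 d2); first by rewrite lt_min d10.
move=> n u v uv tuv; rewrite lt_min => /andP[uvd1 uvd2].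
have H1 := d1P n u v uv tuv uvd1; have H2 := d2P n u v uv tuv uvd2.
apply: (@le_lt_trans _ _ (K * (\sum_(i < n) `|y1 (v i) - y1 (u i)| +
    \sum_(i < n) `|y2 (v i) - y2 (u i)|))).
  rewrite -big_split mulr_sumr; apply: ler_sum => i _.
  by have [au uvi vb] := uv i; exact: yK.
set S1 := \sum_(i < n) _ in H1 *; set S2 := \sum_(i < n) _ in H2 *.
have S10 : 0 <= S1 by apply: sumr_ge0.
apply: (@le_lt_trans _ _ ((K + 1) * (S1 + S2))).
  by apply: ler_wpM2r; [apply: addr_ge0 => //; apply: sumr_ge0|lra].
rewrite mulrC -ltr_pdivlMr//.
have -> : e / (K + 1) = e / (2 * (K + 1)) + e / (2 * (K + 1)).
  by field; rewrite gt_eqF.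
exact: ltrD.
Qed.

Lemma continuous_itv_bounded y a b : a <= b -> continuous y ->
  exists2 M, 0 < M & forall x, a <= x -> x <= b -> `|y x| <= M.
Proof.
move=> ab cy.
have cny : {within `[a, b], continuous (fun x => `|y x|)}.
  apply: continuous_subspaceT => x.
  by apply: continuous_comp; [exact: cy|exact: norm_continuous].
have [c _ cP] := EVT_max ab cny.
exists (`|y c| + 1); first by rewrite ltr_wpDl.
move=> x ax xb; apply: (@le_trans _ _ `|y c|); last by rewrite lerDl.
by apply: cP; rewrite in_itv/= ax.
Qed.

Lemma abs_continuous_locB y z : abs_continuous_loc y -> abs_continuous_loc z ->
  abs_continuous_loc (fun x => y x - z x).
Proof.
move=> acy acz a b ab.
apply: (@abs_continuous_itv_dominated _ _ _ y z 1 _ _ (acy _ _ ab) (acz _ _ ab)) => // u v _ _ _.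
rewrite mul1r (_ : _ - _ = (y v - y u) - (z v - z u)); last by ring.
exact: ler_normB.
Qed.

Lemma abs_continuous_locM y z : abs_continuous_loc y -> abs_continuous_loc z ->
  abs_continuous_loc (fun x => y x * z x).
Proof.
move=> acy acz a b ab.
have [M M0 MP] := continuous_itv_bounded _ _ _ ab (abs_continuous_loc_continuous _ acy).
have [N N0 NP] := continuous_itv_bounded _ _ _ ab (abs_continuous_loc_continuous _ acz).
apply: (@abs_continuous_itv_dominated _ _ _ y z (M + N) _ _ (acy _ _ ab) (acz _ _ ab)).
  by rewrite addr_ge0// ltW.
move=> u v au uv vb.
rewrite (_ : _ - _ = (y v - y u) * z v + y u * (z v - z u)); last by ring.
apply: (le_trans (ler_normD _ _)); rewrite !normrM mulrDr lerD//.
  rewrite mulrC ler_wpM2r//; apply: (le_trans (NP _ _ _)) => //; lra.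
rewrite ler_wpM2r//; apply: (le_trans (MP _ _ _)) => //; lra.
Qed.

(** On []-oo, M]] the exponential is Lipschitz with constant [expR M], where [M] bounds [|y|] on the
    interval. *)
Lemma abs_continuous_loc_expR y : abs_continuous_loc y ->
  abs_continuous_loc (fun x => expR (y x)).
Proof.
move=> acy a b ab.
have [M M0 MP] := continuous_itv_bounded _ _ _ ab (abs_continuous_loc_continuous _ acy).
apply: (@abs_continuous_itv_dominated _ _ _ y y (expR M) _ _ (acy _ _ ab) (acy _ _ ab)).
  exact: expR_ge0.
have H s t : s <= t -> t <= M -> expR t - expR s <= expR M * (t - s).
  move=> st tM.
  have -> : expR t - expR s = expR t * (1 - expR (s - t)).
    by rewrite mulrBr mulr1 -expRD [t + _]addrC subrK.
  apply: (@le_trans _ _ (expR t * (t - s))).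
    rewrite ler_pM2l ?expR_gt0//; have := expR_ge1Dx (s - t); lra.
  by rewrite ler_wpM2r ?ler_expR// subr_ge0.
have H' s t : `|s| <= M -> `|t| <= M -> `|expR t - expR s| <= expR M * `|t - s|.
  wlog st : s t / s <= t.
    move=> W sM tM; have [st|/ltW ts] := leP s t; first exact: W.
    by rewrite distrC [`|t - s|]distrC; exact: W.
  move=> _ /ler_normlW tM; rewrite !ger0_norm ?subr_ge0 ?ler_expR//.
  exact: H.
move=> u v au uv vb.
apply: (@le_trans _ _ (expR M * `|y v - y u|)).
  apply: H'; apply: MP => //; lra.
by rewrite ler_pM2l ?expR_gt0// lerDl.
Qed.

End abs_continuous.

(** * Absolutely continuous functions whose derivative vanishes almost everywhere *)

Section zero_derivative.
Context {R : realType}.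
Local Notation mu := (@lebesgue_measure R).
Implicit Types (y : R -> R) (a b : R).

Let disjoint_lt := fun q p : R * R => p.2 <= q.1.

(* The finitely many intervals of [s], listed from right to left, carry the part
   of the increment of [y] over [a, x] that is not controlled by [e * (x - a)]. *)
Let covered y (U : set R) (e a x : R) (s : seq (R * R)) :=
  [/\ pairwise disjoint_lt s,
      forall i, i \in s -> [/\ a <= i.1, i.1 <= i.2, i.2 <= x &
        `]i.1, i.2[ `<=` U] &
      `|y x - y a| <= e * (x - a) + \sum_(i <- s) `|y i.2 - y i.1|].

Let covered_extend y U e a x x' s : 0 <= e -> a <= x -> x <= x' ->
  `|y x' - y x| <= e * (x' - x) \/ `]x, x'[ `<=` U ->
  covered y U e a x s -> exists s', covered y U e a x' s'.
Proof.
move=> e0 ax xx' H [ps sP ys].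
have tri : `|y x' - y a| <= `|y x' - y x| + `|y x - y a| by exact: ler_distD.
have sP' i : i \in s -> [/\ a <= i.1, i.1 <= i.2, i.2 <= x' & `]i.1, i.2[ `<=` U].
  by move=> /sP[? ? ix ?]; split => //; exact: le_trans xx'.
case: H => [yxx'|xx'U].
  by exists s; split => //; lra.
exists ((x, x') :: s); split.
- rewrite pairwise_cons ps andbT; apply/allP => i /sP[_ _ ix _].
  exact: ix.
- by move=> i; rewrite inE => /predU1P[->//|/sP'].
- rewrite big_cons/=; have : 0 <= e * (x' - x) by rewrite mulr_ge0// subr_ge0.
  lra.
Qed.

(** At a point of zero derivative the increments over [[u, x]] and [[x, v]] are both small, and
    their bounds add up because [x] lies between [u] and [v]. Otherwise a ball around [x] lies in
    [U]. *)
Let local_control y U e x : open U -> 0 < e ->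
  (derivable y x 1 /\ derive1 y x = 0) \/ U x ->
  exists2 r : R, 0 < r & forall u v, x - r < u -> u <= x -> x <= v -> v < x + r ->
    `|y v - y u| <= e * (v - u) \/ `]u, v[ `<=` U.
Proof.
move=> oU e0 [[dy y'0]|Ux].
  have : (h^-1 *: (y (h + x) - y x)) @[h --> 0^'] --> (0 : R).
    rewrite -[X in _ --> X]y'0 /derive1; move: dy; rewrite /derivable.
    set F := fun h => _ *: _; set G := fun h => _ *: _.
    have -> : F = G by apply/funext => h; rewrite /F /G /= [h *: 1]mulr1.
    exact.
  move=> /cvgrPdist_le /(_ e e0) /nbhs_ballP[r r0 rP].
  have {}rP t : `|t - x| < r -> `|y t - y x| <= e * `|t - x|.
    have [->|tx tr] := eqVneq t x; first by rewrite !subrr normr0 mulr0.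
    have := rP (t - x); rewrite /ball /= !sub0r !normrN subr_eq0 subrK.
    rewrite normrM normfV => /(_ tr tx).
    by rewrite mulrC ler_pdivrMr// normr_gt0 subr_eq0.
  exists r => // u v xu ux xv vx; left.
  have H1 : `|y v - y x| <= e * (v - x).
    by rewrite -[v - x]ger0_norm ?subr_ge0//; apply: rP; rewrite ger0_norm; lra.
  have H2 : `|y x - y u| <= e * (x - u).
    rewrite distrC -[x - u]ger0_norm ?subr_ge0// [`|x - u|]distrC.
    by apply: rP; rewrite ler0_norm; lra.
  have := ler_distD (y x) (y v) (y u); lra.
have [r /= r0 rP] := oU _ Ux; exists r => // u v xu ux xv vx; right => t /=.
rewrite in_itv/= => /andP[ut tv]; apply: rP.
by rewrite /ball /= ltr_norml; lra.
Qed.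

(** Continuous induction: local control holds at the supremum of the points reached from [a], so a
    family ending close to it extends past it unless it equals [b]. *)
Let covered_itv y (U : set R) e a b : open U -> 0 < e -> a <= b ->
  (forall x, (derivable y x 1 /\ derive1 y x = 0) \/ U x) ->
  exists s, covered y U e a b s.
Proof.
move=> oU e0 ab yU.
pose S := [set x | a <= x <= b /\ exists s, covered y U e a x s].
have Sa : S a.
  split; first by rewrite lexx ab.
  by exists [::]; split => //; rewrite big_nil !subrr mulr0 addr0 normr0.
have ubS : has_ubound S by exists b => x [/andP[]].
have supS : has_sup S by split => //; exists a.
have ac : a <= sup S by exact: ub_le_sup.
have cb : sup S <= b by apply: ge_sup; [exists a|move=> x [/andP[]]].
have [r r0 rP] := local_control y U e (sup S) oU e0 (yU _).
have [x [/andP[ax xb] [s sP]] rx] := sup_adherent r0 supS.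
have xc : x <= sup S by apply: ub_le_sup => //; split; [rewrite ax|exists s].
have ext x' : sup S <= x' -> x' < sup S + r -> exists s', covered y U e a x' s'.
  move=> cx' x'r; apply: (@covered_extend y U e a x x' s) => //.
  - exact: ltW.
  - exact: le_trans cx'.
  - exact: rP.
have [cb'|bc] := ltP (sup S) b; last by apply: ext => //; lra.
pose x' := Num.min b (sup S + r / 2).
have x'b : x' <= b by rewrite ge_min lexx.
have x'r : x' <= sup S + r / 2 by rewrite ge_min lexx orbT.
have cx' : sup S < x' by rewrite lt_min cb'; lra.
have : S x' by split; [rewrite x'b andbT; lra|apply: ext; lra].
by move=> /(ub_le_sup ubS); lra.
Qed.

(** The exceptional null set lies in an open [U] of measure less than [d]. The increment splits into
    a part of size at most [e' * (b - a)] and increments over disjoint intervals inside [U], which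
    sum to less than [e'] by absolute continuity. *)
Lemma abs_continuous_derive0_cst y : abs_continuous_loc y ->
  {ae mu, forall x, derivable y x 1 /\ derive1 y x = 0} ->
  forall a b, y a = y b.
Proof.
move=> acy [N [mN N0 yN]].
suff H a b : a <= b -> y a = y b.
  move=> a b; have [ab|/ltW ba] := leP a b; first exact: H.
  by apply/esym/H.
move=> ab; apply/eqP; rewrite eq_sym -subr_eq0 -normr_eq0; apply/eqP/le_anti.
rewrite normr_ge0 andbT; apply/ler_addgt0Pr => e e0; rewrite add0r.
have c0 : 0 < b - a + 1 by lra.
have e0' : 0 < e / (b - a + 1) by rewrite divr_gt0.
set e' := e / (b - a + 1) in e0'.
have [d d0 dP] := acy a b ab e' e0'.
have [U [oU NU muU]] : exists U : set R, [/\ open U, N `<=` U & (mu U < d%:E)%E].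
  have N_lty : (mu N < +oo)%E by rewrite [X in (X < _)%E]N0.
  have [U [oU NU UN]] := lebesgue_regularity_outer mN N_lty d0; exists U; split => //.
  have mU : measurable U by exact: open_measurable.
  apply: le_lt_trans UN.
  rewrite (measureDI mu mU mN) [X in (_ + X)%E](_ : _ = 0%E) ?adde0//.
  by apply: subset_measure0 N0 => //; exact: measurableI.
have yU x : (derivable y x 1 /\ derive1 y x = 0) \/ U x.
  by have [H|H] := pselect (derivable y x 1 /\ derive1 y x = 0);
    [left|right; apply/NU/yN].
have [s [ps sP ys]] := covered_itv y U e' a b oU e0' ab yU.
pose u (i : 'I_(size s)) := (nth (0, 0) s i).1.
pose v (i : 'I_(size s)) := (nth (0, 0) s i).2.
have suv (i : 'I_(size s)) : [/\ a <= u i, u i <= v i, v i <= b & `]u i, v i[ `<=` U].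
  by apply: sP; exact: mem_nth.
have tuv : trivIset setT (fun i => `]u i, v i[%classic).
  apply/trivIsetP => i j _ _; wlog ij : i j / (i < j)%N.
    move=> W; rewrite neq_ltn => /orP[ij|ij]; first exact: W ij (negbT (ltn_eqF ij)).
    by rewrite setIC; exact: W ij (negbT (ltn_eqF ij)).
  move=> _; apply/seteqP; split => // x [] /=.
  rewrite !in_itv/= => /andP[ux _] /andP[_ xv].
  have : v j <= u i by move/(pairwiseP (0, 0)) : ps => /(_ i j); rewrite !inE/=; exact.
  by move=> vu; have := lt_trans ux xv; rewrite ltNge vu.
have muuv : (\sum_(i < size s) (v i - u i) < d).
  rewrite -lte_fin; apply: le_lt_trans muU.
  have mI (i : 'I_(size s)) : measurable (`]u i, v i[%classic) by exact: measurable_itv.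
  have mD : measurable (\big[setU/set0]_(i < size s) `]u i, v i[%classic).
    exact: bigsetU_measurable.
  apply: (@le_trans _ _ (mu (\big[setU/set0]_(i < size s) `]u i, v i[%classic))).
    rewrite [leRHS]measure_semi_additive_ord// -sumEFin; apply: lee_sum => i _.
    rewrite [leRHS]lebesgue_measure_itv/= lte_fin; have [_ uvi _ _] := suv i.
    by case: ltgtP uvi => // -> _; rewrite subrr.
  apply: le_measure; rewrite ?inE//; first exact: open_measurable.
  apply: (big_ind (fun X => X `<=` U)) => // [X Y XU YU|i _].
    by rewrite subUset.
  by have [] := suv i.
have := dP _ u v (fun i => let: And4 h1 h2 h3 _ := suv i in And3 h1 h2 h3) tuv muuv.
rewrite -(big_mkord xpredT (fun i => `|y (nth (0, 0) s i).2 - y (nth (0, 0) s i).1|)).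
rewrite -(big_nth (0, 0) xpredT (fun i => `|y i.2 - y i.1|)) => ys'.
apply: (le_trans ys).
have -> : e = e' * (b - a) + e' by rewrite /e'; field; rewrite gt_eqF.
by rewrite lerD2l ltW.
Qed.

End zero_derivative.

(** * Growth of [d] along cells of mass 2 *)

Section cells.
Context {R : realType} (Q d : R -> R).
Hypothesis Q_homo : {homo Q : x y / x <= y}.
Hypothesis Q_unbounded : forall M, exists x, M < Q x.
Hypothesis Q_unboundedN : forall M, exists x, Q x < M.
Hypothesis d_gt0 : forall x, 0 < d x.
Hypothesis Q_d : forall x, Q (x + d x) = Q (x - d x) + 2.
Hypothesis d_min : forall x e, 0 <= e -> Q (x - e) + 2 <= Q (x + e) -> d x <= e.

Lemma Q_lt_le x y : Q x < Q y -> x <= y.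
Proof. by move=> Qxy; apply: contraLR Qxy; rewrite -ltNge -leNgt => /ltW/Q_homo. Qed.

(** The interval of radius [d x + |x - y|] about [y] contains the cell of [x], hence has mass at
    least 2. *)
Lemma d_lipschitz x y : d y <= d x + `|x - y|.
Proof.
apply: d_min; first by rewrite addr_ge0// ltW.
have : Q (y - (d x + `|x - y|)) <= Q (x - d x).
  by apply: Q_homo; have := ler_norm (y - x); rewrite distrC; lra.
have : Q (x + d x) <= Q (y + (d x + `|x - y|)).
  by apply: Q_homo; have := ler_norm (x - y); lra.
by have := Q_d x; lra.
Qed.

Lemma d_continuous : continuous d.
Proof.
move=> x; apply/cvgrPdist_le => e e0; apply/nbhs_ballP; exists e => //= y.
rewrite /ball/= => xy; apply: le_trans (ltW xy); rewrite ler_norml.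
have := d_lipschitz x y; have := d_lipschitz y x; rewrite [`|y - x|]distrC; lra.
Qed.

(** Intermediate value theorem for [m - d m]: it is below [x] at [m = x], and at least [x] at the
    midpoint of an interval [[x, T]] of mass more than 2, since [d] there is at most half the
    length. *)
Lemma cell_right x : exists m, m - d m = x /\ Q (m + d m) = Q x + 2.
Proof.
have [T QT] := Q_unbounded (Q x + 2).
have xT : x <= T by apply: Q_lt_le; lra.
have dm1 : d ((x + T) / 2) <= (T - x) / 2.
  apply: d_min; first lra.
  by rewrite (_ : _ - _ = x) 1?(_ : _ + (T - x) / 2 = T); [lra|field|field].
have cf : {within `[x, (x + T) / 2], continuous (fun m => m - d m)}.
  apply: continuous_subspaceT => z; apply: cvgB => //; exact: d_continuous.
have xm : x <= (x + T) / 2 by lra.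
have [|m _ mx] := @IVT _ _ _ _ x xm cf.
  by rewrite ge_min le_max; have := d_gt0 x => dx; apply/andP; split; apply/orP; [left|right]; lra.
by exists m; rewrite Q_d mx.
Qed.

Lemma cell_left t : exists m, m + d m = t /\ Q t = Q (m - d m) + 2.
Proof.
have [S QS] := Q_unboundedN (Q t - 2).
have St : S <= t by apply: Q_lt_le; lra.
have dm1 : d ((S + t) / 2) <= (t - S) / 2.
  apply: d_min; first lra.
  by rewrite (_ : _ - _ = S) 1?(_ : _ + (t - S) / 2 = t); [lra|field|field].
have cf : {within `[(S + t) / 2, t], continuous (fun m => m + d m)}.
  apply: continuous_subspaceT => z; apply: cvgD => //; exact: d_continuous.
have tm : (S + t) / 2 <= t by lra.
have [|m _ mx] := @IVT _ _ _ _ t tm cf.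
  by rewrite ge_min le_max; have := d_gt0 t => dt; apply/andP; split; apply/orP; [left|right]; lra.
by exists m; rewrite -Q_d mx.
Qed.

(** * Consequences of the class K condition *)

Section class_K.
Variables a b x0 : R.
Hypothesis a_ge1 : 1 <= a.
Hypothesis b_ge : a ^+ 2 * (1 + ln a) <= b.
Hypothesis K : forall x, x0 <= `|x| -> forall t, `|t - x| <= b * d x ->
  a^-1 * d x <= d t /\ d t <= a * d x.

Let ln_a : 0 <= ln a. Proof. exact: ln_ge0. Qed.

Let b_ge1 : 1 <= b.
Proof.
have a2 : 1 <= a ^+ 2 by exact: exprn_ege1.
by apply: le_trans b_ge; apply: (le_trans a2); rewrite ler_peMr ?lerDl//; lra.
Qed.

Let K_rev x t : x0 <= `|x| -> `|t - x| <= b * d x -> d x <= a * d t.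
Proof.
move=> x0x tx; have [+ _] := K x x0x t tx.
by rewrite ler_pdivrMl// (lt_le_trans ltr01).
Qed.

Let K_dir x t : x0 <= `|x| -> `|t - x| <= b * d x -> d t <= a * d x.
Proof. by move=> x0x tx; have [_] := K x x0x t tx. Qed.

(** Both ends of the cell are within [d m <= b * d m] of its centre, so passing between an end and
    the centre costs one factor [a]. *)
Lemma one_cell x m : m - d m = x -> x0 <= `|m| ->
  d m <= a * d x /\ d (m + d m) <= a ^+ 2 * d x.
Proof.
move=> mx x0m; have dm := d_gt0 m.
have bdm : d m <= b * d m by rewrite ler_peMl// ltW.
have dmx : d m <= a * d x.
  by apply: K_rev => //; rewrite -mx addrAC subrr sub0r normrN gtr0_norm.
split => //; have := K_dir m (m + d m) x0m.
rewrite addrAC subrr add0r gtr0_norm// => /(_ bdm) /le_trans; apply.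
by rewrite expr2 -mulrA ler_wpM2l// (le_trans ler01).
Qed.

(** The successive cells have centres within [b * d x] of [x], where [d <= a * d x], so each has
    length at most [2 * a * d x]. *)
Lemma cells_within N x : x0 <= `|x| -> 2 * a * N%:R <= b ->
  exists y, [/\ x <= y, y <= x + 2 * a * N%:R * d x & Q y = Q x + 2 * N%:R].
Proof.
move=> x0x; have a1 := a_ge1; have b1 := b_ge1; have dx := d_gt0 x.
elim: N => [|N IH].
  by move=> _; exists x; rewrite !mulr0 mul0r !addr0.
rewrite -natr1 => NB; have [|y [xy yx Qy]] := IH; first lra.
have [m [my Qm]] := cell_right y; have dm := d_gt0 m.
(* As [d] is 1-Lipschitz, [t - d t] is nondecreasing, and a centre beyond [T] would give
   [T - d T <= y]. But [d T <= a * d x] and [y <= T - 2 * a * d x]. *)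
have mb : m <= x + b * d x.
  rewrite leNgt; apply/negP => bm; set T := x + b * d x in bm.
  have dT : d T <= a * d x.
    by apply: K_dir => //; rewrite /T addrAC subrr add0r ger0_norm// mulr_ge0 ?ltW//; lra.
  have : T - d T <= y.
    by have := d_lipschitz T m; rewrite -my ltr0_norm ?subr_lt0//; lra.
  by rewrite /T; nra.
have dmx : d m <= a * d x by apply: K_dir => //; rewrite ger0_norm; lra.
by exists (m + d m); split; [lra|nra|rewrite Qm Qy; ring].
Qed.


(* For [a <= 2] a single cell multiplies [d] by at most [a ^+ 2 <= 4 < e ^ 2].
   For [a > 2] the interval [x, x + b d(x)] contains [N > ln a / 2] cells, so
   that [d] grows by a factor [a < e ^ (2 N)] while [Q] grows by [2 N]. *)
Lemma growth_step : exists A r s L : R,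
  [/\ 0 <= A, 0 < s, r * expR (- s) < 1, x0 <= L &
    forall x, x0 <= x \/ x <= - L ->
      exists y, [/\ x <= y, y <= x + A * d x, d y <= r * d x & Q x + s <= Q y]].
Proof.
have a1 := a_ge1; have b1 := b_ge1; have a0 : 0 < a by lra.
have [a2|a2] := leP a 2.
  (* For [x <= z], even the right end of the cell started at [x] has [Q] below [Q (- x0)], so the
     centre lies left of [- x0]. *)
  have [z Qz] := Q_unboundedN (Q (- x0) - 2).
  exists (2 * a), (a ^+ 2), 2, (Num.max x0 (- z)); split; first lra.
  - lra.
  - have e1 : 2 < expR 1 :> R.
      by have := @expR_gt1Dx R 1 (oner_neq0 _); lra.
    have -> : expR (- 2) = (expR 1 ^+ 2)^-1 :> R.
      by rewrite expRN; congr (_^-1); rewrite -expRM_natl mulr1.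
    rewrite ltr_pdivrMr ?exprn_gt0 ?expR_gt0// mul1r ltr_pXn2r ?nnegrE ?expR_ge0//; lra.
  - by rewrite le_max lexx.
  - move=> x xx; have [m [mx Qm]] := cell_right x; have dm := d_gt0 m.
    have x0m : x0 <= `|m|.
      case: xx => xx; first by apply: le_trans (ler_norm _); lra.
      apply: (@le_trans _ _ (- m)); last by rewrite -normrN ler_norm.
      rewrite lerNr; apply/ltW; rewrite ltNge; apply/negP => /Q_homo mx0.
      have xz : x <= z by apply: (le_trans xx); rewrite lerNl le_max lexx orbT.
      have Qxz := Q_homo _ _ xz.
      have : Q m <= Q (m + d m) by apply: Q_homo; lra.
      lra.
    have [dmx ?] := one_cell x m mx x0m.
    by exists (m + d m); split => //; [lra|lra|rewrite Qm].
have lna : 0 <= ln a by exact: ln_a.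
have /andP[tle tgt] : (Num.truncn (ln a / 2))%:R <= ln a / 2 < (Num.truncn (ln a / 2)).+1%:R.
  by apply: truncn_itv; lra.
set N := (Num.truncn (ln a / 2)).+1 in tgt.
have NE : N%:R = (Num.truncn (ln a / 2))%:R + 1 :> R by rewrite natr1.
(* As [N <= ln a / 2 + 1], it suffices that [a * ln a + 2 * a <= a ^ 2 * (1 + ln a)], true for
   [a > 2]. *)
have NB : 2 * a * N%:R <= b.
  apply: le_trans b_ge; apply: (@le_trans _ _ (2 * a * (ln a / 2 + 1))).
    by rewrite ler_pM2l ?NE; lra.
  have : 0 <= a * (a - 2) by apply: mulr_ge0; lra.
  have : 0 <= a * (ln a * (a - 1)) by rewrite !mulr_ge0//; lra.
  lra.
exists b, a, (2 * N%:R), x0; split => //; first lra.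
- have : 0 <= (Num.truncn (ln a / 2))%:R :> R by [].
  by rewrite NE; lra.
- rewrite -{1}(lnK (x := a)) ?posrE// -expRD expR_lt1; lra.
- move=> x xx; have x0x : x0 <= `|x|.
    case: xx => xx; first by apply: le_trans (ler_norm _).
    by apply: (@le_trans _ _ (- x)); [rewrite lerNr|rewrite -normrN ler_norm].
  have dx := d_gt0 x; have [y [xy yx Qy]] := cells_within N x x0x NB.
  have ybx : y <= x + b * d x by nra.
  exists y; split => //; last by rewrite Qy.
  by apply: K_dir => //; rewrite ger0_norm; lra.
Qed.


(** * Row integrals *)

Section forward_bound.
Variable E : R -> R.
Hypothesis E_homo : {homo E : x y / x <= y}.
Hypothesis E_le : forall x y, x <= y -> E y - E x <= expR (- Q x) * (y - x).

(** [E] stands for a primitive of [exp (- Q)]; this is the row estimate at [x], uniform in the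
    truncation [T]. *)
Let bounded_by C x := forall T, x <= T -> E T - E x <= C * (d x * expR (- Q x)).

Let bounded_by_le C C' x : C <= C' -> bounded_by C x -> bounded_by C' x.
Proof.
move=> CC' Cx T xT; apply: le_trans (Cx T xT) _.
by rewrite ler_wpM2r// mulr_ge0 ?expR_ge0// ltW.
Qed.

(** A step costs [A] times the weight [d x * exp (- Q x)] and multiplies this weight by at most
    [r * exp (- s)], so the constant [C] reproduces itself. The induction is on the number of steps
    of mass [s] that exhaust [Q T - Q x]; a path may leave [G] at a point already bounded. *)
Let bounded_by_step A r s C (G : set R) : 0 <= A -> 0 < s -> A <= C ->
  A + C * (r * expR (- s)) <= C ->
  (forall x, G x -> exists y, [/\ x <= y, y <= x + A * d x, d y <= r * d x,
    Q x + s <= Q y & G y \/ bounded_by C y]) ->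
  forall x, G x -> bounded_by C x.
Proof.
move=> A0 s0 leAC rC step x Gx T xT.
have [n Tn] : exists n, Q T <= Q x + n%:R * s.
  exists (Num.truncn ((Q T - Q x) / s)).+1.
  by rewrite -lerBlDl -ler_pdivrMr// ltW// truncnS_gt.
have C0 : 0 <= C by exact: le_trans leAC.
have start y u z : z <= y -> u <= z -> y <= u + A * d u ->
    E z - E u <= A * (d u * expR (- Q u)).
  move=> zy uz yu; apply: le_trans (E_le _ _ uz) _.
  by rewrite mulrA [X in _ <= X]mulrC ler_wpM2l ?expR_ge0//; lra.
have startC y u z : z <= y -> u <= z -> y <= u + A * d u ->
    E z - E u <= C * (d u * expR (- Q u)).
  move=> zy uz yu; apply: le_trans (start y u z zy uz yu) _.
  by rewrite ler_wpM2r// mulr_ge0 ?expR_ge0// ltW.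
elim: n x T Gx xT Tn => [|n IH] x T Gx xT Tn;
  have [y [xy yx dy Qy GCy]] := step x Gx; have dx := d_gt0 x.
- apply: (startC y) => //; apply: Q_lt_le; move: Tn; rewrite mul0r; lra.
- have [Ty|/ltW yT] := leP T y; first exact: (startC y).
  have ETy : E T - E y <= C * (d y * expR (- Q y)).
    case: GCy => [Gy|]; last exact.
    by apply: IH => //; move: Tn; rewrite -natr1 mulrDl mul1r; lra.
  have dQy : d y * expR (- Q y) <= r * expR (- s) * (d x * expR (- Q x)).
    rewrite mulrACA -expRD; apply: ler_pM => //; first exact/ltW.
    by rewrite ler_expR; lra.
  apply: (@le_trans _ _ ((A + C * (r * expR (- s))) * (d x * expR (- Q x)))).
    have := start y x y (lexx _) xy yx; have := ler_wpM2l C0 dQy.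
    by rewrite mulrDl -mulrA; lra.
  by rewrite ler_wpM2r// mulr_ge0 ?expR_ge0// ltW.
Qed.

(** Three zones: right of [x0] the steps stay there; [[- L, x0]] is compact; left of [- L] steps are
    taken until they enter a zone already bounded. *)
Lemma forward_bound : 0 <= x0 -> exists2 C, 0 < C &
  forall x T, x <= T -> E T - E x <= C * (d x * expR (- Q x)).
Proof.
move=> x0_ge0; have [A [r [s [L [A0 s0 rho1 x0L step]]]]] := growth_step.
set rho := r * expR (- s) in rho1.
have rho0 : 0 <= rho.
  have [|y [_ _ dy _]] := step x0; first by left.
  have := d_gt0 y; have dx := d_gt0 x0 => dy0.
  rewrite mulr_ge0 ?expR_ge0// -(pmulr_lge0 _ dx); lra.
(* The fixed point of [C = A + C * rho]; larger values of [C] remain stable. *)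
pose C1 := A / (1 - rho).
have C1E C : C1 <= C -> A <= C /\ A + C * rho <= C.
  rewrite ler_pdivrMr ?subr_gt0// => leAC.
  have C0 : 0 <= C by rewrite -(@pmulr_lge0 _ (1 - rho)) ?subr_gt0; lra.
  have : 0 <= C * rho by exact: mulr_ge0.
  by split; lra.
have bound1 x : x0 <= x -> bounded_by C1 x.
  have [leAC1 rC1] := C1E C1 (lexx _).
  apply: (bounded_by_step A r s C1 [set x | x0 <= x]) => // {}x /= x0x.
  have [|y [xy yx dy Qy]] := step x; first by left.
  by exists y; split => //; left => /=; exact: le_trans xy.
have dV : continuous (fun x => (d x)^-1).
  by move=> x; apply: cvgV; [rewrite gt_eqF|exact: d_continuous].
have Lx0 : - L <= x0 by lra.
have [M M0 MP] := continuous_itv_bounded _ _ _ Lx0 dV.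
(* [x0 + L] accounts for the part up to [x0], [C1 * d x0] for the part beyond, and [1 <= M * d x] on
   this zone restores the factor [d x]. *)
pose C2 := M * (x0 + L + C1 * d x0).
have C10 : 0 <= C1 by rewrite divr_ge0//; lra.
have bound2 x : - L <= x -> x <= x0 -> bounded_by C2 x.
  move=> Lx xx0 T xT; have dx := d_gt0 x; have eQx := expR_gt0 (- Q x).
  have E0 : E x0 - E x <= expR (- Q x) * (x0 + L).
    by apply: le_trans (E_le _ _ xx0) _; rewrite ler_pM2l//; lra.
  have ET : E T - E x0 <= expR (- Q x) * (C1 * d x0).
    have d0 : 0 <= C1 * d x0 by rewrite mulr_ge0// ltW.
    have [Tx0|/ltW x0T] := leP T x0.
      apply: (@le_trans _ _ 0); first by rewrite subr_le0 E_homo.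
      by rewrite mulr_ge0// ltW.
    apply: le_trans (bound1 _ (lexx _) _ x0T) _.
    rewrite mulrA mulrC ler_wpM2r// ler_expR lerN2; exact: Q_homo.
  apply: (@le_trans _ _ (expR (- Q x) * (x0 + L + C1 * d x0))); first lra.
  have dM : 1 <= M * d x.
    have := MP x Lx xx0; rewrite gtr0_norm ?invr_gt0// -[(d x)^-1]mul1r.
    by rewrite ler_pdivrMr.
  have S0 : 0 <= x0 + L + C1 * d x0.
    by apply: addr_ge0; [lra|rewrite mulr_ge0// ltW].
  rewrite /C2 (_ : _ * (_ * _) = expR (- Q x) * (M * d x * (x0 + L + C1 * d x0))).
    by rewrite ler_pM2l// ler_peMl.
  by ring.
pose C := Num.max C1 C2.
have C1C : C1 <= C by rewrite le_max lexx.
have C2C : C2 <= C by rewrite le_max lexx orbT.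
have bound12 x : - L <= x -> bounded_by C x.
  move=> Lx; have [xx0|/ltW x0x] := leP x x0.
    exact: bounded_by_le C2C (bound2 _ Lx xx0).
  exact: bounded_by_le C1C (bound1 _ x0x).
have [leAC rC] := C1E C C1C.
have bound x : bounded_by C x.
  have [Lx|/ltW xL] := leP (- L) x; first exact: bound12.
  move: x xL; apply: (bounded_by_step A r s C [set x | x <= - L]) => // x /= xL.
  have [|y [xy yx dy Qy]] := step x; first by right.
  exists y; split => //; have [yL|/ltW Ly] := leP y (- L); first by left.
  by right; exact: bound12.
exists (C + 1); first by rewrite ltr_wpDl// (le_trans C10).
by move=> x; apply: bounded_by_le (bound x); rewrite lerDl.
Qed.

End forward_bound.

(** * Column integrals *)

Section backward_bound.
Variables (theta P : R -> R) (c : R).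
Hypothesis theta_cont : continuous theta.
Hypothesis theta_d : forall x, theta x * d x <= c.
Hypothesis P_homo : {homo P : x y / x <= y}.
Hypothesis P_le : forall M x y, x <= y ->
  (forall z, x <= z -> z <= y -> theta z <= M) ->
  P y - P x <= expR (Q y) * (M * (y - x)).

(** For far [t] the step is the cell ending at [t]: its length [2 * d m] cancels the denominator in
    [theta <= a * c / d m]. For [t] in the compact middle the step is one jump to [w]. *)
Let backward_step : 0 <= x0 -> 0 <= c -> exists2 A, 0 <= A & forall t,
  exists y, [/\ y <= t, Q y + 2 <= Q t & P t - P y <= A * expR (Q t)].
Proof.
move=> x0_ge0 c0; have a1 := a_ge1; have b1 := b_ge1.
(* A cell ending right of [z] starts right of [x0]; a jump from any [t >= - x0] to [w] covers mass
   at least 2. *)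
have [z Qz] := Q_unbounded (Q x0 + 2).
have [w Qw] := Q_unboundedN (Q (- x0) - 2).
have xz : x0 <= z by apply: Q_lt_le; lra.
have wx : w <= - x0 by apply: Q_lt_le; lra.
have wz : w <= z by lra.
have [M M0 MP] := continuous_itv_bounded _ _ _ wz theta_cont.
exists (2 * (a * c) + M * (z - w)).
  by rewrite addr_ge0 ?mulr_ge0//; lra.
move=> t; have eQt := expR_gt0 (Q t).
have ac0 : 0 <= a * c by rewrite mulr_ge0//; lra.
have Mzw : 0 <= M * (z - w) by rewrite mulr_ge0//; lra.
have [[x0t tz]|far] := pselect (- x0 <= t /\ t <= z).
  exists w; split; first lra.
    by have := Q_homo _ _ x0t; lra.
  apply: le_trans (P_le M _ _ _ _) _; first lra.
    by move=> x wx' xt; apply: le_trans (ler_norm _) (MP _ _ _) => //; lra.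
  rewrite mulrC ler_wpM2r ?(ltW eQt)//.
  apply: (@le_trans _ _ (M * (z - w))); last lra.
  by rewrite ler_pM2l//; lra.
have [m [mt Qt]] := cell_left t; have dm := d_gt0 m.
have x0m : x0 <= `|m|.
  have [tx|xt] := ltP t (- x0).
    by apply: (@le_trans _ _ (- m)); [lra|rewrite -normrN ler_norm].
  have zt : z < t by rewrite ltNge; apply/negP => tz; apply: far.
  apply: le_trans (ler_norm _); have : x0 <= m - d m; last lra.
  by apply: Q_lt_le; have := Q_homo _ _ (ltW zt); lra.
exists (m - d m); split; [lra|lra|].
have theta_m x : m - d m <= x -> x <= t -> theta x <= a * c / d m.
  move=> mx xt; have dx := d_gt0 x.
  have dmx : d m <= a * d x.
    apply: K_rev => //; apply: (@le_trans _ _ (d m)); first by rewrite ler_norml; lra.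
    by rewrite ler_peMl// ltW.
  have theta0 : theta x <= c / d x by rewrite ler_pdivlMr.
  apply: (le_trans theta0); rewrite ler_pdivrMr// mulrAC ler_pdivlMr//.
  by have := ler_wpM2l c0 dmx; lra.
apply: le_trans (P_le _ _ _ _ theta_m) _; first lra.
rewrite mulrC ler_wpM2r ?(ltW eQt)// -mt.
rewrite (_ : a * c / d m * _ = 2 * (a * c)); first lra.
by field; rewrite gt_eqF.
Qed.

(** Each step to the left multiplies the weight [exp (Q t)] by at most [exp (- 2)], so the costs
    form a geometric series and [C] solves [A + C * exp (- 2) = C]. *)
Lemma backward_bound : 0 <= x0 -> 0 <= c -> exists2 C, 0 < C &
  forall x T, x <= T -> P T - P x <= C * expR (Q T).
Proof.
move=> x0_ge0 c0; have [A A0 step] := backward_step x0_ge0 c0.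
have e2 : expR (- 2) < 1 :> R by rewrite expR_lt1; lra.
have e20 := expR_gt0 (- 2 : R).
pose C := A / (1 - expR (- 2)).
have CE : A + C * expR (- 2) = C by rewrite /C; field; lra.
have C0 : 0 <= C by rewrite divr_ge0//; lra.
have leAC : A <= C by have := mulr_ge0 C0 (ltW e20); lra.
exists (C + 1); first lra.
move=> x T xT; have eQT := expR_gt0 (Q T).
suff : P T - P x <= C * expR (Q T) by lra.
have [n Tn] : exists n, Q T <= Q x + n%:R * 2.
  exists (Num.truncn ((Q T - Q x) / 2)).+1.
  by rewrite -lerBlDl -ler_pdivrMr// ltW// truncnS_gt.
elim: n T xT Tn eQT => [|n IH] T xT Tn eQT; have [y [yT QyT PyT]] := step T.
  have yx : y <= x by apply: Q_lt_le; move: Tn; rewrite mul0r; lra.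
  apply: (@le_trans _ _ (A * expR (Q T))); last by rewrite ler_wpM2r// ltW.
  by have := P_homo _ _ yx; lra.
(* The last step may overshoot [x]; monotonicity of [P] absorbs this. *)
have [xy|/ltW yx] := leP x y; last first.
  apply: (@le_trans _ _ (A * expR (Q T))); last by rewrite ler_wpM2r// ltW.
  by have := P_homo _ _ yx; lra.
have Pyx : P y - P x <= C * expR (Q y).
  by apply: IH => //; [move: Tn; rewrite -natr1; lra|exact: expR_gt0].
have Qy : expR (Q y) <= expR (- 2) * expR (Q T) by rewrite -expRD ler_expR; lra.
have := ler_wpM2l C0 Qy; rewrite -[in X in _ -> X]CE; lra.
Qed.

End backward_bound.
End class_K.
End cells.

(** * The function [d_fun] *)

Section half_lines.
Context {R : realType}.
Local Notation mu := (@lebesgue_measure R).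
Implicit Types f g G : R -> R.

Let integral_bigcup_le (F : (set R)^nat) f (M : \bar R) :
  measurable_fun setT f -> (forall x, 0 <= f x) ->
  nondecreasing_seq F -> (forall i, measurable (F i)) ->
  (forall i, (\int[mu]_(x in F i) (f x)%:E <= M)%E) ->
  (\int[mu]_(x in \bigcup_i F i) (f x)%:E <= M)%E.
Proof.
move=> mf f0 ndF mF FM.
have FC : ((\int[mu]_(x in F i) (f x)%:E)%E @[i --> \oo] -->
    (\int[mu]_(x in \bigcup_i F i) (f x)%:E)%E).
  apply: ge0_nondecreasing_set_cvg_integral => // [i|i x _].
    exact/measurable_funTS/measurable_EFinP.
  by rewrite lee_fin.
have <- := cvg_lim (@ereal_hausdorff R) FC.
by apply: lime_le; [apply/cvg_ex; exists (\int[mu]_(x in \bigcup_i F i) (f x)%:E)%E|apply: nearW].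
Qed.

Lemma integral_itvy_le f a (M : \bar R) :
  measurable_fun setT f -> (forall x, 0 <= f x) ->
  (forall b, a <= b -> (\int[mu]_(x in `[a, b]) (f x)%:E <= M)%E) ->
  (\int[mu]_(x in `[a, +oo[) (f x)%:E <= M)%E.
Proof.
move=> mf f0 fM; rewrite (itv_bndy_bigcup_BRight true a).
apply: integral_bigcup_le => // [m n mn|i]; last first.
  by apply: fM; rewrite lerDl.
by apply/subsetPset/subset_itvl; rewrite bnd_simp lerD2l ler_nat.
Qed.

Lemma integral_itvNy_le f b (M : \bar R) :
  measurable_fun setT f -> (forall x, 0 <= f x) ->
  (forall a, a <= b -> (\int[mu]_(x in `[a, b]) (f x)%:E <= M)%E) ->
  (\int[mu]_(x in `]-oo, b]) (f x)%:E <= M)%E.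
Proof.
move=> mf f0 fM; rewrite (itvNy_bnd_bigcup_BLeft false b).
apply: integral_bigcup_le => // [m n mn|i]; last first.
  by apply: fM; rewrite gerBl.
by apply/subsetPset/subset_itvr; rewrite bnd_simp lerD2l lerN2 ler_nat.
Qed.

Lemma integral_primitive g G a b : locally_integrable [set: R] g ->
  is_primitive g G -> a <= b ->
  (\int[mu]_(t in `[a, b]) (g t)%:E = (G b - G a)%:E)%E.
Proof.
move=> lg gG ab; rewrite -gG// /Rintegral fineK//.
exact/integrable_fin_num/locally_integrable_itv.
Qed.

Lemma primitive_homo g G : (forall x, 0 <= g x) -> is_primitive g G ->
  {homo G : x y / x <= y}.
Proof.
by move=> g0 gG x y xy; rewrite -subr_ge0 -gG//; apply: Rintegral_ge0.
Qed.

Lemma primitive_unbounded g G : locally_integrable [set: R] g ->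
  (forall x, 0 <= g x) -> is_primitive g G ->
  (\int[mu]_(t in `[0%R, +oo[) (g t)%:E = +oo)%E ->
  forall M, exists x, M < G x.
Proof.
move=> lg g0 gG goo M; apply/not_existsP => GM.
suff : (\int[mu]_(t in `[0%R, +oo[) (g t)%:E <= (M - G 0)%:E)%E by rewrite goo.
case: (lg) => mg _ _.
apply: integral_itvy_le => // b b0; rewrite (integral_primitive _ _ _ _ lg gG b0).
by rewrite lee_fin lerD2r leNgt; apply/negP/GM.
Qed.

Lemma primitive_unboundedN g G : locally_integrable [set: R] g ->
  (forall x, 0 <= g x) -> is_primitive g G ->
  (\int[mu]_(t in `]-oo, 0%R]) (g t)%:E = +oo)%E ->
  forall M, exists x, G x < M.
Proof.
move=> lg g0 gG goo M; apply/not_existsP => GM.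
suff : (\int[mu]_(t in `]-oo, 0%R]) (g t)%:E <= (G 0 - M)%:E)%E by rewrite goo.
case: (lg) => mg _ _.
apply: integral_itvNy_le => // b b0; rewrite (integral_primitive _ _ _ _ lg gG b0).
by rewrite lee_fin lerD2l lerN2 leNgt; apply/negP/GM.
Qed.

End half_lines.

(** * The infimum defining [d_fun] is attained *)

Section d_fun.
Context {R : realType} (q Q : R -> R).
Local Notation mu := (@lebesgue_measure R).
Hypothesis q_loc : locally_integrable [set: R] q.
Hypothesis q_ge0 : forall x, 0 <= q x.
Hypothesis qQ : is_primitive q Q.
Hypothesis Q_unbounded : forall M, exists x, M < Q x.

Let Q_homo : {homo Q : x y / x <= y}.
Proof. exact: primitive_homo qQ. Qed.

Let Q_cont : continuous Q.
Proof. exact: (abs_continuous_loc_continuous _ (primitive_abs_continuous _ _ q_loc qQ)). Qed.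

Let radii x := [set e | 0 <= e /\ Q (x + e) - Q (x - e) = 2].

Let d_funE x : d_fun q x = inf (radii x).
Proof.
congr inf; apply/seteqP; split => e /= [e0 qe]; split => //.
  by apply: EFin_inj; rewrite -qe; apply/esym/integral_primitive => //; lra.
by rewrite (integral_primitive _ _ _ _ q_loc qQ) ?qe//; lra.
Qed.

Let radii_cont x : continuous (fun e => Q (x + e) - Q (x - e)).
Proof.
have c1 : continuous (fun e => x + e).
  by move=> e; apply: cvgD; [exact: cvg_cst|exact: cvg_id].
have c2 : continuous (fun e => x - e).
  by move=> e; apply: cvgB; [exact: cvg_cst|exact: cvg_id].
move=> e; apply: cvgB; first exact: (continuous_comp (c1 e) (Q_cont _)).
exact: (continuous_comp (c2 e) (Q_cont _)).
Qed.

Let radius_below x e : 0 <= e -> 2 <= Q (x + e) - Q (x - e) ->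
  exists2 e', radii x e' & e' <= e.
Proof.
move=> e0 Qe.
have [|e' ee' Qe'] := @IVT _ _ _ _ 2 e0 (continuous_subspaceT (radii_cont x)).
  by rewrite addr0 subr0 subrr ge_min le_max Qe orbT andbT; lra.
by move: ee'; rewrite in_itv/= => /andP[e'0 e'e]; exists e'.
Qed.

(** Radii of mass exactly 2 lie arbitrarily close to the infimum, so by continuity the mass there is
    not below 2; the intermediate value theorem then gives a radius no larger than the infimum. *)
Let inf_radii x : radii x (inf (radii x)).
Proof.
have lb : has_lbound (radii x) by exists 0 => e [].
have [e Se] : radii x !=set0.
  have [z Qz] := Q_unbounded (Q x + 2).
  have xz : x <= z by rewrite leNgt; apply/negP => /ltW/Q_homo; lra.
  have [||e Se _] := radius_below x (z - x); [lra| |by exists e].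
  have := Q_homo (x - (z - x)) x; rewrite [x + (z - x)]addrC subrK; lra.
have i0 : 0 <= inf (radii x) by apply: lb_le_inf; [exists e|move=> ? []].
have Qi : 2 <= Q (x + inf (radii x)) - Q (x - inf (radii x)).
  rewrite leNgt; apply/negP => Q2.
  have := radii_cont x (inf (radii x)) => /cvgr_lt/(_ _ Q2) /nbhs_ballP[r /= r0 rP].
  have [|e' Se' e'i] := @inf_adherent _ (radii x) r r0; first by split; [exists e|].
  have ie' : inf (radii x) <= e' by exact: ge_inf.
  have := rP e'; rewrite /ball /= ler0_norm; last lra.
  case: Se' => _ -> H; have : 2 < 2 :> R by apply: H; lra.
  by rewrite ltxx.
have [e' Se' e'i] := radius_below x _ i0 Qi.
by have -> : inf (radii x) = e' by apply/le_anti; rewrite e'i ge_inf.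
Qed.

Lemma Q_d_fun x : Q (x + d_fun q x) = Q (x - d_fun q x) + 2.
Proof. by rewrite d_funE; have [_] := inf_radii x; lra. Qed.

Lemma d_fun_gt0 x : 0 < d_fun q x.
Proof.
rewrite lt_neqAle; have [i0 Qi] := inf_radii x; rewrite d_funE i0 andbT.
by apply/eqP => i00; move: Qi; rewrite -i00 addr0 subr0 subrr; lra.
Qed.

Lemma d_fun_min x e : 0 <= e -> Q (x - e) + 2 <= Q (x + e) -> d_fun q x <= e.
Proof.
move=> e0 Qe; rewrite d_funE; have [|e' Se' e'e] := radius_below x e e0; first lra.
by apply: le_trans e'e; apply: ge_inf => //; exists 0 => ? [].
Qed.

End d_fun.

(** * Schur test and Green operator *)

Section weighted_hoelder.
Context d (T : measurableType d) (R : realType) (mu : {measure set T -> \bar R}).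
Implicit Types (w f : T -> R) (p M : R).

(** Hoelder for [w |f| = (w ^ (1/p) |f|) * w ^ (1/r)] with [r] conjugate to [p]; the second norm to
    the power [p] is the integral of [w] to the power [p - 1]. *)
Let weighted_hoelderT w f p M : measurable_fun setT w -> measurable_fun setT f ->
  (forall x, 0 <= w x) -> 1 <= p -> 0 <= M ->
  (\int[mu]_x (w x)%:E <= M%:E)%E ->
  ((\int[mu]_x (w x * `|f x|)%:E) `^ p <=
    (M `^ (p - 1))%:E * \int[mu]_x (w x * `|f x| `^ p)%:E)%E.
Proof.
move=> mw mf w0 p1 M0 wM.
have mnf : measurable_fun setT (fun x => `|f x|) by exact: measurableT_comp.
(* At [p = 1] the conjugate exponent is infinite, but both sides coincide. *)
have [->|pN1] := eqVneq p 1.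
  rewrite poweRe1; last by apply: integral_ge0 => x _; rewrite lee_fin mulr_ge0.
  rewrite subrr powRr0 mul1e le_eqVlt; apply/orP; left; apply/eqP.
  by apply: eq_integral => x _; rewrite powRr1.
have {pN1}p1 : 1 < p by rewrite lt_neqAle eq_sym pN1.
have p0 : 0 < p by lra.
pose r := p / (p - 1).
have r0 : 0 < r by rewrite divr_gt0//; lra.
have pr : p^-1 + r^-1 = 1 by rewrite /r; field; lra.
pose g1 x := w x `^ p^-1 * `|f x|.
pose g2 x := w x `^ r^-1.
have mg1 : measurable_fun setT g1.
  apply: measurable_funM => //.
  by apply: (measurableT_comp (f := @powR R ^~ p^-1)) => //; exact: measurable_powR.
have mg2 : measurable_fun setT g2.
  by apply: (measurableT_comp (f := @powR R ^~ r^-1)) => //; exact: measurable_powR.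
have := hoelder mu mg1 mg2 p0 r0 pr.
rewrite Lnorm1.
under eq_integral => x _.
  rewrite /= /g1 /g2 mulrAC -powRD; last by rewrite pr oner_eq0.
  rewrite pr powRr1// ger0_norm ?mulr_ge0//.
  over.
move=> H.
have I0 : (0 <= \int[mu]_x (w x * `|f x|)%:E)%E.
  by apply: integral_ge0 => x _; rewrite lee_fin mulr_ge0.
have mono := @gt0_ler_poweR R p (ltW p0).
have {}H := mono _ _ _ _ H.
apply: le_trans (H _ _) _; [by rewrite in_itv/= I0 leey|by rewrite in_itv/= mule_ge0 ?Lnorm_ge0 ?leey|].
rewrite poweRM ?Lnorm_ge0// poweR_Lnorm ?gt_eqF// muleC.
have N2 : ('N[mu]_r%:E[EFin \o g2] `^ p <= (M `^ (p - 1))%:E)%E.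
  have -> : ('N[mu]_r%:E[EFin \o g2] `^ p =
      ('N[mu]_r%:E[EFin \o g2] `^ r) `^ (p - 1))%E.
    by rewrite -poweRrM; congr (_ `^ _)%E; rewrite /r; field; lra.
  rewrite poweR_Lnorm ?gt_eqF//.
  under eq_integral => x _.
    rewrite /= /g2 ger0_norm ?powR_ge0// ?poweR_EFin -powRrM mulVf ?gt_eqF// powRr1//.
    over.
  have w_ge0 : (0 <= \int[mu]_x (w x)%:E)%E by apply: integral_ge0 => x _; rewrite lee_fin.
  rewrite -poweR_EFin; apply: gt0_ler_poweR => //; rewrite ?in_itv/= ?leey ?andbT ?lee_fin//; lra.
apply: lee_pmul => //; first exact: poweR_ge0.
  by apply: integral_ge0 => x _; rewrite poweR_ge0.
under eq_integral => x _.
  rewrite /= /g1 ger0_norm ?mulr_ge0 ?powR_ge0// ?poweR_EFin powRM ?powR_ge0//.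
  rewrite -powRrM mulVf ?gt_eqF// powRr1//.
  over.
by [].
Qed.

Lemma weighted_hoelder (D : set T) w f p M : measurable D ->
  measurable_fun setT w -> measurable_fun setT f ->
  (forall x, 0 <= w x) -> 1 <= p -> 0 <= M ->
  (\int[mu]_(x in D) (w x)%:E <= M%:E)%E ->
  ((\int[mu]_(x in D) (w x * `|f x|)%:E) `^ p <=
    (M `^ (p - 1))%:E * \int[mu]_(x in D) (w x * `|f x| `^ p)%:E)%E.
Proof.
move=> mD mw mf w0 p1 M0.
have H h : (\int[mu]_(x in D) (w x * h x)%:E = \int[mu]_x ((w \_ D) x * h x)%:E)%E.
  rewrite integral_mkcond; apply: eq_integral => x _.
  by rewrite !patchE; case: ifP => // _; rewrite mul0r.
rewrite !H => wM; apply: weighted_hoelderT => //.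
- by apply/(measurable_restrictT _ _).1 => //; exact: measurable_funTS.
- by move=> x; rewrite patchE; case: ifP.
- by move: wM; under eq_integral do rewrite -[w _]mulr1; rewrite H; under eq_integral do rewrite mulr1.
Qed.

End weighted_hoelder.

(** * Tonelli on the triangle [x <= t] *)

Section triangle.
Context {R : realType}.
Local Notation mu := (@lebesgue_measure R).

(** The half-line integral is a section integral of a kernel cut off to [x <= t], to which Tonelli's
    measurability applies. *)
Lemma measurable_integral_itvy (h : R -> R) :
  measurable_fun setT h -> (forall x, 0 <= h x) ->
  measurable_fun setT (fun x : R => \int[mu]_(t in `[x, +oo[) (h t)%:E)%E.
Proof.
move=> mh h0.
pose k (z : R * R) : \bar R := (if z.1 <= z.2 then h z.2 else 0)%:E.
have mk : measurable_fun setT k.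
  apply/measurable_EFinP; apply: measurable_fun_ifT => //.
    exact: measurable_fun_ler.
  exact: measurableT_comp.
have k0 z : (0 <= k z)%E by rewrite /k lee_fin; case: ifP.
have -> : (fun x : R => \int[mu]_(t in `[x, +oo[) (h t)%:E)%E =
    (fun x : R => \int[mu]_t k (x, t))%E.
  apply/funext => x; rewrite integral_mkcond; apply: eq_integral => t _.
  by rewrite patchE /k/= mem_setE in_itv/= andbT; case: ifP.
exact: (@measurable_fun_fubini_tonelli_F _ _ _ _ R mu k mk k0).
Qed.

Lemma measurable_integral_itvNy (g : R -> R) :
  measurable_fun setT g -> (forall x, 0 <= g x) ->
  measurable_fun setT (fun t : R => \int[mu]_(x in `]-oo, t]) (g x)%:E)%E.
Proof.
move=> mg g0.
pose k (z : R * R) : \bar R := (if z.1 <= z.2 then g z.1 else 0)%:E.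
have mk : measurable_fun setT k.
  apply/measurable_EFinP; apply: measurable_fun_ifT => //.
    exact: measurable_fun_ler.
  exact: measurableT_comp.
have k0 z : (0 <= k z)%E by rewrite /k lee_fin; case: ifP.
have -> : (fun t : R => \int[mu]_(x in `]-oo, t]) (g x)%:E)%E =
    (fun t : R => \int[mu]_x k (x, t))%E.
  apply/funext => t; rewrite integral_mkcond; apply: eq_integral => x _.
  by rewrite patchE /k/= mem_setE in_itv/=; case: ifP.
exact: (@measurable_fun_fubini_tonelli_G _ _ _ _ R mu k mk k0).
Qed.

Lemma tonelli_triangle (g h : R -> R) :
  measurable_fun setT g -> measurable_fun setT h ->
  (forall x, 0 <= g x) -> (forall x, 0 <= h x) ->
  (\int[mu]_x ((g x)%:E * \int[mu]_(t in `[x, +oo[) (h t)%:E) =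
   \int[mu]_t ((h t)%:E * \int[mu]_(x in `]-oo, t]) (g x)%:E))%E.
Proof.
move=> mg mh g0 h0.
pose k (z : R * R) : \bar R := (if z.1 <= z.2 then g z.1 * h z.2 else 0)%:E.
have mk : measurable_fun setT k.
  apply/measurable_EFinP; apply: measurable_fun_ifT => //.
    exact: measurable_fun_ler.
  by apply: measurable_funM; apply: measurableT_comp.
have k0 z : (0 <= k z)%E by rewrite /k lee_fin; case: ifP => // _; rewrite mulr_ge0.
transitivity (\int[mu]_x \int[mu]_t k (x, t))%E.
  apply: eq_integral => x _; rewrite -ge0_integralZl_EFin//; last 2 first.
  - by move=> t _; rewrite lee_fin.
  - exact/measurable_funTS/measurable_EFinP.
  rewrite integral_mkcond; apply: eq_integral => t _.
  rewrite patchE /k/= mem_setE in_itv/= andbT.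
  by case: ifP.
transitivity (\int[mu]_t \int[mu]_x k (x, t))%E.
  exact: (@fubini_tonelli _ _ _ _ R mu mu k mk k0).
apply: eq_integral => t _.
rewrite -ge0_integralZl_EFin//; last 2 first.
- by move=> x _; rewrite lee_fin.
- exact/measurable_funTS/measurable_EFinP.
rewrite [RHS]integral_mkcond; apply: eq_integral => x _.
rewrite patchE /k/= mem_setE in_itv/=.
by case: ifP => // _; rewrite EFinM muleC.
Qed.

End triangle.

(** * Linear bounds for primitives, local integrability *)

Section primitive_bounds.
Context {R : realType}.
Local Notation mu := (@lebesgue_measure R).
Implicit Types (f g G y : R -> R).

Lemma compact_le_norm (K : set R) : compact K ->
  exists2 r, 0 < r & forall x, K x -> `|x| <= r.
Proof.
move=> /compact_bounded[M [_ MP]]; exists (Num.max 1 (M + 1)).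
  by rewrite lt_max ltr01.
by move=> x Kx; apply: (MP _ _ x Kx); rewrite lt_max ltrDl ltr01 orbT.
Qed.

Lemma continuous_locally_integrable f : continuous f ->
  locally_integrable [set: R] f.
Proof.
move=> cf; split; [exact: continuous_measurable_fun|exact: openT|].
move=> K _ cK.
have /integrableP[_] := @continuous_compact_integrable R f K cK (continuous_subspaceT cf).
by [].
Qed.

Lemma primitive_le_linear g G M a b : locally_integrable [set: R] g ->
  is_primitive g G -> a <= b -> (forall t, a <= t -> t <= b -> g t <= M) ->
  G b - G a <= M * (b - a).
Proof.
move=> lg gG ab gM; rewrite -gG//.
have -> : M * (b - a) = \int[mu]_(t in `[a, b]) M.
  rewrite Rintegral_cst// [X in fine X]lebesgue_measure_itv/= lte_fin.
  by case: ltgtP ab => // -> _; rewrite subrr.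
apply: le_Rintegral => //; first exact: locally_integrable_itv.
  by apply: locally_integrable_itv; apply: continuous_locally_integrable; exact: cst_continuous.
by move=> t; rewrite /= in_itv/= => /andP[at_ tb]; exact: gM.
Qed.

Lemma primitiveN g G : locally_integrable [set: R] g ->
  is_primitive g G -> is_primitive (fun t => - g t) (fun t => - G t).
Proof.
move=> lg gG a b ab; rewrite -opprD -gG// -mulN1r -RintegralZl//.
  by apply: eq_Rintegral => t _; rewrite mulN1r.
exact: locally_integrable_itv.
Qed.

Lemma primitive_ge_linear g G M a b : locally_integrable [set: R] g ->
  is_primitive g G -> a <= b -> (forall t, a <= t -> t <= b -> M <= g t) ->
  M * (b - a) <= G b - G a.
Proof.
move=> lg gG ab gM; rewrite -lerN2 -mulNr opprD.
apply: primitive_le_linear (primitiveN _ _ lg gG) ab _.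
  exact: locally_integrableN.
by move=> t at_ tb; rewrite lerN2 gM.
Qed.

Lemma continuous_Lp_loc (p : R) y : 0 < p -> continuous y -> Lp_loc p y.
Proof.
move=> p0 cy; split; first exact: continuous_measurable_fun.
move=> K cK.
have [r r0 rP] := compact_le_norm _ cK.
have [|N N0 NP] := continuous_itv_bounded y (- r) r _ cy; first lra.
have mK : measurable K by exact: compact_measurable.
apply: (@le_lt_trans _ _ (\int[mu]_(x in K) (N `^ p)%:E)%E).
  apply: ge0_le_integral => //.
  - apply/measurable_EFinP/(measurableT_comp (f := @powR R ^~ p)).
      exact: measurable_powR.
    apply: measurableT_comp => //.
    by apply: measurable_funTS; exact: continuous_measurable_fun.
  - move=> x Kx; have /andP[rx xr] : - r <= x <= r by rewrite -ler_norml rP.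
    by rewrite lee_fin ge0_ler_powR ?nnegrE ?NP// ltW.
rewrite integral_cst// lte_mul_pinfty ?lee_fin ?powR_ge0//.
exact: compact_finite_measure.
Qed.

End primitive_bounds.

(** * The Green operator and its weighted bound *)

Section green_operator.
Context {R : realType} (q Q theta d : R -> R) (C1 C2 c p : R).
Local Notation mu := (@lebesgue_measure R).
Hypothesis q_loc : locally_integrable [set: R] q.
Hypothesis qQ : is_primitive q Q.
Hypothesis Q_homo : {homo Q : x y / x <= y}.
Hypothesis d_gt0 : forall x, 0 < d x.
Hypothesis C1_gt0 : 0 < C1.
Hypothesis kernel_row : forall x,
  (\int[mu]_(t in `[x, +oo[) (expR (- Q t))%:E <= (C1 * (d x * expR (- Q x)))%:E)%E.
Hypothesis theta_cont : continuous theta.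
Hypothesis theta_gt0 : forall x, 0 < theta x.
Hypothesis theta_d : forall x, theta x * d x <= c.
Hypothesis C2_gt0 : 0 < C2.
Hypothesis kernel_col : forall t,
  (\int[mu]_(x in `]-oo, t]) (theta x * expR (Q x))%:E <= (C2 * expR (Q t))%:E)%E.
Hypothesis p_ge1 : 1 <= p.

Let Q_ac : abs_continuous_loc Q.
Proof. exact: (primitive_abs_continuous _ _ q_loc qQ). Qed.

Let Q_cont : continuous Q.
Proof. exact: abs_continuous_loc_continuous. Qed.

Let expQ_cont : continuous (fun x => expR (Q x)).
Proof. exact: (abs_continuous_loc_continuous _ (abs_continuous_loc_expR _ Q_ac)). Qed.

Let expNQ_cont : continuous (fun x => expR (- Q x)).
Proof.
by move=> x; apply: continuous_comp; [exact/continuousN/Q_cont|exact: continuous_expR].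
Qed.

Section solution.
Variable f : R -> R.
Hypothesis f_meas : measurable_fun setT f.
Hypothesis f_int : (\int[mu]_x (`|f x| `^ p)%:E < +oo)%E.

Let fp_meas : measurable_fun setT (fun x => `|f x| `^ p).
Proof.
apply: (measurableT_comp (f := @powR R ^~ p)); first exact: measurable_powR.
exact: measurableT_comp.
Qed.

Let J x := (\int[mu]_(t in `[x, +oo[) (expR (- Q t) * `|f t| `^ p)%:E)%E.

Let J_ge0 x : (0 <= J x)%E.
Proof. by apply: integral_ge0 => t _; rewrite lee_fin mulr_ge0 ?expR_ge0 ?powR_ge0. Qed.

Let J_lty x : (J x < +oo)%E.
Proof.
apply: (@le_lt_trans _ _ ((expR (- Q x))%:E * \int[mu]_x (`|f x| `^ p)%:E)%E); last first.
  by rewrite lte_mul_pinfty ?lee_fin ?expR_ge0.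
rewrite -ge0_integralZl_EFin ?expR_ge0//; last exact/measurable_EFinP.
apply: (@le_trans _ _ (\int[mu]_(t in `[x, +oo[) ((expR (- Q x))%:E * (`|f t| `^ p)%:E))%E).
  apply: ge0_le_integral => //.
  - apply/measurable_EFinP/measurable_funTS/measurable_funM => //.
    exact: continuous_measurable_fun.
  - apply/measurable_funTS/emeasurable_funM => //; exact/measurable_EFinP.
  - move=> t; rewrite /= in_itv/= andbT => xt.
    rewrite -EFinM lee_fin ler_wpM2r ?powR_ge0// ler_expR lerN2; exact: Q_homo.
apply: ge0_subset_integral => //.
  by apply/emeasurable_funM => //; exact/measurable_EFinP.
Qed.

Let I x := (\int[mu]_(t in `[x, +oo[) (expR (- Q t) * `|f t|)%:E)%E.

Let I_ge0 x : (0 <= I x)%E.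
Proof. by apply: integral_ge0 => t _; rewrite lee_fin mulr_ge0 ?expR_ge0. Qed.

(** Weighted Hoelder with weight [exp (- Q)], whose mass on [[x, +oo[] is bounded by the row
    estimate. *)
Let I_le x :
  (I x `^ p <= ((C1 * (d x * expR (- Q x))) `^ (p - 1))%:E * J x)%E.
Proof.
apply: weighted_hoelder => //.
- exact: continuous_measurable_fun.
- exact: mulr_ge0 (ltW C1_gt0) (mulr_ge0 (ltW (d_gt0 x)) (expR_ge0 _)).
Qed.

(** This makes the tail integral in the Green operator absolutely convergent. *)
Let I_lty x : (I x < +oo)%E.
Proof.
have p0 : p != 0 by have := p_ge1; move=> p1; apply/eqP => p0; move: p1; rewrite p0; lra.
apply: (@lty_poweRy _ _ p) => //; apply: le_lt_trans (I_le x) _.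
by rewrite lte_mul_pinfty ?lee_fin ?powR_ge0.
Qed.

Let g t := expR (- Q t) * f t.

Let g_meas : measurable_fun setT g.
Proof. by apply: measurable_funM => //; exact: continuous_measurable_fun. Qed.

Let g_int x : mu.-integrable `[x, +oo[ (EFin \o g).
Proof.
apply/integrableP; split; first exact/measurable_funTS/measurable_EFinP.
rewrite [X in (X < _)%E](_ : _ = I x) ?I_lty//.
by apply: eq_integral => t _; rewrite /= /g normrM ger0_norm// expR_ge0.
Qed.

Let g_loc : locally_integrable [set: R] g.
Proof.
split; [exact: g_meas|exact: openT|move=> K _ cK].
have [r r0 rP] := compact_le_norm _ cK.
have : mu.-integrable K (EFin \o g).
  apply: integrableS (g_int (- r)) => //; first exact: compact_measurable.
  by move=> x Kx /=; rewrite in_itv/= andbT; have := rP x Kx; rewrite ler_norml => /andP[].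
by move=> /integrableP[].
Qed.

Let G x := - \int[mu]_(t in `[x, +oo[) g t.

Let gG : is_primitive g G.
Proof.
move=> a b ab.
have := @Rintegral_itvB R g (BLeft a) +oo%O b (g_int a).
rewrite bnd_simp => /(_ ab isT) H.
rewrite /G opprK addrC -[X in _ = _ - X](@Rintegral_itv_obnd_cbnd R b +oo%O); last first.
  by apply: integrableS (g_int b) => //; apply: subset_itvr; rewrite bnd_simp.
by rewrite -H; ring.
Qed.

Definition green x := expR (Q x) * \int[mu]_(t in `[x, +oo[) g t.

Let W x := \int[mu]_(t in `[x, +oo[) g t.

Let gW : is_primitive (fun t => - g t) W.
Proof. by move=> a b ab; rewrite (primitiveN _ _ g_loc gG a b ab) /G !opprK. Qed.

Let Ng_loc : locally_integrable [set: R] (fun t => - g t).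
Proof. exact: locally_integrableN. Qed.

Lemma green_abs_continuous : abs_continuous_loc green.
Proof.
apply: abs_continuous_locM; first exact: abs_continuous_loc_expR.
exact: (primitive_abs_continuous _ _ Ng_loc gW).
Qed.

Lemma green_solution : is_solution q f green.
Proof.
split; first exact: green_abs_continuous.
have := primitive_derivable _ _ Ng_loc gW.
have := primitive_derivable _ _ q_loc qQ.
apply: filterS2; first exact: (ae_filter_ringOfSetsType mu).
move=> x [dQ Q'] [dW W'].
have iQ : is_derive x 1 Q (q x) by apply: DeriveDef => //; rewrite -derive1E.
have iW : is_derive x 1 W (- g x) by apply: DeriveDef => //; rewrite -derive1E.
have ieQ : is_derive x 1 (fun x => expR (Q x)) (expR (Q x) * q x).
  exact: is_derive1_comp.
have iy : is_derive x 1 green (expR (Q x) *: (- g x) + W x *: (expR (Q x) * q x)).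
  exact: is_deriveM.
split; first exact: ex_derive.
rewrite derive1E derive_val /green -/(W x) /g.
rewrite [in LHS]/GRing.scale/= (_ : expR (Q x) * - _ = - f x); first by ring.
by rewrite mulrN mulrA -expRD subrr expR0 mul1r.
Qed.

Let W_le x : (`|W x|%:E <= I x)%E.
Proof.
rewrite EFin_normr_Rintegral//.
apply: le_trans (le_abse_integral _ _ _) _ => //.
  exact/measurable_funTS/measurable_EFinP.
rewrite le_eqVlt; apply/orP; left; apply/eqP.
by apply: eq_integral => t _; rewrite /= /g normrM ger0_norm// expR_ge0.
Qed.

(** One factor of [(theta * exp Q) ^ p] is kept for the column integral; the other [p - 1] meet the
    row constant, where [exp Q] cancels [exp (- Q)] and [theta * d <= c]. *)
Let pointwise x : ((`|theta x * green x| `^ p)%:E <=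
  ((C1 * c) `^ (p - 1))%:E * ((theta x * expR (Q x))%:E * J x))%E.
Proof.
have th0 := theta_gt0 x; have eQ := expR_gt0 (Q x); have eNQ := expR_gt0 (- Q x).
have dx := d_gt0 x; have C10 := C1_gt0; have p1 := p_ge1.
have p0 : 0 <= p by lra.
have pm0 : 0 <= p - 1 by lra.
have tQ0 : 0 <= theta x * expR (Q x) by rewrite mulr_ge0// ltW.
have K0 : 0 <= C1 * (d x * expR (- Q x)) by rewrite mulr_ge0 ?mulr_ge0// ltW.
have -> : `|theta x * green x| = theta x * expR (Q x) * `|W x|.
  by rewrite /green -/(W x) mulrA normrM (ger0_norm tQ0).
rewrite powRM// EFinM -poweR_EFin.
have WI : (`|W x|%:E `^ p <= I x `^ p)%E.
  by apply: gt0_ler_poweR => //; rewrite ?in_itv/= ?leey ?andbT ?lee_fin ?I_ge0.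
apply: (@le_trans _ _ (((theta x * expR (Q x)) `^ p)%:E *
    (((C1 * (d x * expR (- Q x))) `^ (p - 1))%:E * J x)))%E.
  by rewrite lee_wpmul2l ?lee_fin ?powR_ge0//; apply: le_trans WI (I_le x).
rewrite !muleA lee_wpmul2r// -!EFinM lee_fin.
have tE : theta x * expR (Q x) * (C1 * (d x * expR (- Q x))) <= C1 * c.
  rewrite (_ : _ * _ = C1 * (theta x * d x) * (expR (Q x) * expR (- Q x))).
    by rewrite -expRD subrr expR0 mulr1 ler_pM2l.
  by ring.
rewrite [in leRHS]mulrC; set t := theta x * expR (Q x) in tQ0 tE *.
rewrite -(@mulr_powRB1 _ t p)//; last lra.
rewrite -mulrA -powRM// ler_wpM2l//.
apply: ge0_ler_powR => //; rewrite nnegrE; first exact: mulr_ge0.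
exact: le_trans (mulr_ge0 tQ0 K0) tE.
Qed.

(** Schur test: integrate the pointwise bound, exchange the order of integration, and cancel the
    column bound [C2 * exp (Q t)] against [exp (- Q t)]. *)
Lemma green_bound : (\int[mu]_x (`|theta x * green x| `^ p)%:E <=
  ((C1 * c) `^ (p - 1) * C2)%:E * \int[mu]_x (`|f x| `^ p)%:E)%E.
Proof.
have green_cont := abs_continuous_loc_continuous _ green_abs_continuous.
have A0 : 0 <= (C1 * c) `^ (p - 1) by exact: powR_ge0.
have tQ0 x : 0 <= theta x * expR (Q x) by rewrite mulr_ge0 ?expR_ge0// ltW.
have h0 t : 0 <= expR (- Q t) * `|f t| `^ p by rewrite mulr_ge0 ?expR_ge0 ?powR_ge0.
have mtQ : measurable_fun setT (fun x => theta x * expR (Q x)).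
  by apply: measurable_funM; exact: continuous_measurable_fun.
have mh : measurable_fun setT (fun t => expR (- Q t) * `|f t| `^ p).
  by apply: measurable_funM => //; exact: continuous_measurable_fun.
have mJ : measurable_fun setT J by exact: measurable_integral_itvy.
have mtQJ : measurable_fun setT (fun x => (theta x * expR (Q x))%:E * J x)%E.
  by apply: emeasurable_funM => //; exact/measurable_EFinP.
apply: (@le_trans _ _ (\int[mu]_x (((C1 * c) `^ (p - 1))%:E *
    ((theta x * expR (Q x))%:E * J x)))%E).
  apply: ge0_le_integral => //.
  - apply/measurable_EFinP/(measurableT_comp (f := @powR R ^~ p)).
      exact: measurable_powR.
    apply: measurableT_comp => //.
    by apply: measurable_funM; exact: continuous_measurable_fun.
  - by apply: emeasurable_funM.
rewrite ge0_integralZl_EFin//; last first.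
  by move=> x _; rewrite mule_ge0// lee_fin.
rewrite (tonelli_triangle _ _ mtQ mh tQ0 h0) EFinM -muleA lee_wpmul2l//.
rewrite -ge0_integralZl_EFin ?(ltW C2_gt0)//; last exact/measurable_EFinP.
apply: ge0_le_integral => //.
- move=> t _; apply: mule_ge0; first by rewrite lee_fin.
  by apply: integral_ge0 => x _; rewrite lee_fin.
- apply: emeasurable_funM; first exact/measurable_EFinP.
  exact: measurable_integral_itvNy.
- by apply: emeasurable_funM => //; exact/measurable_EFinP.
- move=> t _.
  apply: (@le_trans _ _ ((expR (- Q t) * `|f t| `^ p)%:E * (C2 * expR (Q t))%:E)%E).
    by rewrite lee_wpmul2l// lee_fin.
  rewrite -!EFinM lee_fin.
  rewrite [C2 * expR (Q t)]mulrC mulrACA -expRD addNr expR0 mul1r.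
  by rewrite mulrC.
Qed.

End solution.
End green_operator.

(** * Uniqueness and admissibility *)

Section homogeneous.
Context {R : realType} (q Q : R -> R).
Local Notation mu := (@lebesgue_measure R).
Hypothesis q_loc : locally_integrable [set: R] q.
Hypothesis qQ : is_primitive q Q.

(* [(y1 - y2) exp (- Q)] is absolutely continuous with derivative 0 a.e. *)
Lemma is_solution_diff f y1 y2 : is_solution q f y1 -> is_solution q f y2 ->
  exists k, forall x, y1 x - y2 x = k * expR (Q x).
Proof.
move=> [ac1 sol1] [ac2 sol2].
have acNQ : abs_continuous_loc (fun x => - Q x).
  have := primitive_abs_continuous _ _ _ (primitiveN _ _ q_loc qQ); apply.
  exact: locally_integrableN.
pose z x := (y1 x - y2 x) * expR (- Q x).
have acz : abs_continuous_loc z.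
  apply: abs_continuous_locM; first exact: abs_continuous_locB.
  exact: abs_continuous_loc_expR.
have z' : {ae mu, forall x, derivable z x 1 /\ derive1 z x = 0}.
  have := primitive_derivable _ _ q_loc qQ.
  apply: filterS3 sol1 sol2; first exact: (ae_filter_ringOfSetsType mu).
  move=> x [dy1 y1'] [dy2 y2'] [dQ Q'].
  have i1 : is_derive x 1 y1 (derive1 y1 x) by apply: DeriveDef => //; rewrite -derive1E.
  have i2 : is_derive x 1 y2 (derive1 y2 x) by apply: DeriveDef => //; rewrite -derive1E.
  have iQ : is_derive x 1 Q (q x) by apply: DeriveDef => //; rewrite -derive1E.
  have ieQ : is_derive x 1 (fun x => expR (- Q x)) (expR (- Q x) * - q x).
    by apply: is_derive1_comp; exact: is_deriveN.
  have i12 : is_derive x 1 (fun x => y1 x - y2 x) (derive1 y1 x - derive1 y2 x).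
    exact: is_deriveB.
  have iz : is_derive x 1 z ((y1 x - y2 x) *: (expR (- Q x) * - q x) +
      expR (- Q x) *: (derive1 y1 x - derive1 y2 x)).
    exact: is_deriveM.
  split; first exact: ex_derive.
  rewrite derive1E derive_val /GRing.scale/=.
  have -> : derive1 y1 x = q x * y1 x - f x by rewrite -y1'; ring.
  have -> : derive1 y2 x = q x * y2 x - f x by rewrite -y2'; ring.
  ring.
exists (z 0) => x; rewrite (abs_continuous_derive0_cst _ acz z' 0 x) /z.
by rewrite -mulrA -expRD addNr expR0 mulr1.
Qed.

(** If [k] is nonzero, [theta * (y1 - y2)] has modulus at least [|k| * kappa] on [[0, +oo[], so at
    each point one of the two weighted solutions reaches half of that, and the sum of their [p]-th
    powers has infinite integral. *)
Lemma weighted_solution_unique (theta : R -> R) (p kappa : R) f y1 y2 : 0 < p ->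
  continuous theta -> 0 < kappa ->
  (forall x, 0 <= x -> kappa <= theta x * expR (Q x)) ->
  is_solution q f y1 -> is_solution q f y2 ->
  Lp_weighted p theta y1 -> Lp_weighted p theta y2 -> y1 = y2.
Proof.
move=> p0 theta_cont kappa0 kappaP sol1 sol2 [_ int1] [_ int2].
have [k kP] := is_solution_diff _ _ _ sol1 sol2.
have [k0|kN0] := eqVneq k 0.
  by apply/funext => x; apply/eqP; rewrite -subr_eq0 kP k0 mul0r.
pose e := `|k| * kappa / 2.
have e0 : 0 < e by rewrite divr_gt0// mulr_gt0// normr_gt0.
pose s (y : R -> R) x := (`|theta x * y x| `^ p)%:E.
have ms y : abs_continuous_loc y -> measurable_fun setT (s y).
  move=> /abs_continuous_loc_continuous cy.
  apply/measurable_EFinP/(measurableT_comp (f := @powR R ^~ p)).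
    exact: measurable_powR.
  by apply: measurableT_comp => //; apply: measurable_funM; exact: continuous_measurable_fun.
have ms1 := ms y1 sol1.1; have ms2 := ms y2 sol2.1.
have s0 y x : (0 <= s y x)%E by rewrite lee_fin powR_ge0.
have : (\int[mu]_(x in `[0%R, +oo[) (e `^ p)%:E <= \int[mu]_x (s y1 x + s y2 x))%E.
  apply: (@le_trans _ _ (\int[mu]_(x in `[0%R, +oo[) (s y1 x + s y2 x))%E).
    apply: ge0_le_integral => //.
    - by move=> x _; rewrite lee_fin powR_ge0.
    - by apply: measurable_funTS; exact: emeasurable_funD.
    - move=> x; rewrite /= in_itv/= andbT => x0.
      have H : 2 * e <= `|theta x * y1 x| + `|theta x * y2 x|.
        apply: le_trans (ler_normB _ _).
        rewrite (_ : 2 * e = `|k| * kappa); last by rewrite /e; field.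
        rewrite -mulrBr kP mulrCA normrM.
        rewrite ler_wpM2l//.
        exact: le_trans (kappaP x x0) (ler_norm _).
      rewrite /s -EFinD lee_fin.
      have mono u : e <= `|u| -> e `^ p <= `|u| `^ p.
        by move=> eu; apply: ge0_ler_powR; rewrite ?nnegrE// ltW.
      have [e1|e1] := leP e `|theta x * y1 x|.
        by apply: (@le_trans _ _ (`|theta x * y1 x| `^ p)); [exact: mono|rewrite lerDl powR_ge0].
      apply: (@le_trans _ _ (`|theta x * y2 x| `^ p)); last by rewrite lerDr powR_ge0.
      by apply: mono; lra.
  apply: ge0_subset_integral => //; first exact: emeasurable_funD.
  by move=> x _; exact: adde_ge0.
rewrite integral_cst//= lebesgue_measure_itv/= ltry gt0_muley ?lte_fin ?powR_gt0//.
rewrite leye_eq ge0_integralD// => /eqP oo.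
by have := lte_add_pinfty int1 int2; rewrite oo.
Qed.

End homogeneous.

Lemma Lnorm_le_scale {R : realType} (f g : R -> R) (p A : R) : 0 < p -> 0 <= A ->
  (\int[lebesgue_measure]_x (`|g x| `^ p)%:E <=
    A%:E * \int[lebesgue_measure]_x (`|f x| `^ p)%:E)%E ->
  ('N[@lebesgue_measure R]_(p%:E)[EFin \o g] <=
    (A `^ p^-1)%:E * 'N[@lebesgue_measure R]_(p%:E)[EFin \o f])%E.
Proof.
move=> p0 A0 H; rewrite unlock.
have I0 (h : R -> R) : (0 <= \int[@lebesgue_measure R]_x (`|h x| `^ p)%:E)%E.
  by apply: integral_ge0 => x _; rewrite lee_fin powR_ge0.
rewrite -poweR_EFin -poweRM ?lee_fin//; last exact: I0.
apply: gt0_ler_poweR => //.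
- by rewrite invr_ge0 ltW.
- by rewrite in_itv/= leey andbT; exact: I0.
- by rewrite in_itv/= leey andbT mule_ge0 ?lee_fin//; exact: I0.
Qed.

(** Compare exponents after writing [a = exp (ln a)]. *)
Lemma class_K_constants {R : realType} (a b : R) : 1 <= a ->
  a * expR (- (b / a ^+ 2)) <= expR (- 1) -> a ^+ 2 * (1 + ln a) <= b.
Proof.
move=> a1; have a0 : 0 < a by lra.
rewrite -{1}(lnK (x := a)) ?posrE// -expRD ler_expR => H.
by rewrite mulrC -ler_pdivlMr ?exprn_gt0//; lra.
Qed.

(** * Admissibility from the kernel bounds and uniqueness *)

Theorem theorem3p1 (R : realType) (q theta : R -> R) (gamma : R)
  (q_loc : locally_integrable [set: R] q)
  (q_ge0 : forall x, 0 <= q x)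
  (q_intN : (\int[lebesgue_measure]_(t in `]-oo, 0%R]) (q t)%:E = +oo)%E)
  (q_intP : (\int[lebesgue_measure]_(t in `[0%R, +oo[) (q t)%:E = +oo)%E)
  (q_inf : forall a : R, 0 < a ->
     ereal_inf (range (fun x : R =>
       (\int[lebesgue_measure]_(t in `[(x - a)%R, (x + a)%R]) (q t)%:E)%E))
     = 0%E)
  (q_K : class_K gamma q)
  (gamma_le : gamma <= expR (- 1))
  (theta_cont : continuous theta)
  (theta_gt0 : forall x, 0 < theta x)
  (theta_equiv : weakly_equivalent theta (q_star q))
  (p : R) (p_ge1 : 1 <= p) :
  admissible p theta q.
Proof.
have [Q qQ] := primitive_exists q q_loc.
have Q_homo := primitive_homo q Q q_ge0 qQ.
have Q_unb := primitive_unbounded q Q q_loc q_ge0 qQ q_intP.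
have Q_unbN := primitive_unboundedN q Q q_loc q_ge0 qQ q_intN.
pose d := d_fun q.
have d_gt0 : forall x, 0 < d x := d_fun_gt0 q Q q_loc q_ge0 qQ Q_unb.
have Q_d : forall x, Q (x + d x) = Q (x - d x) + 2 := Q_d_fun q Q q_loc q_ge0 qQ Q_unb.
have d_min : forall x e, 0 <= e -> Q (x - e) + 2 <= Q (x + e) -> d x <= e :=
  d_fun_min q Q q_loc qQ.
have [a [b [x0 [a1 b0 x01 gammaE K]]]] := q_K.
have bE : a ^+ 2 * (1 + ln a) <= b.
  by apply: class_K_constants => //; rewrite -gammaE.
have x00 : 0 <= x0 by lra.
have [c c1 cP] := theta_equiv.
have c0 : 0 < c by lra.
(* Of the two halves of the equivalence, the upper one feeds the boundedness of the operator, the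
   lower one uniqueness. *)
have theta_le x : theta x * d x <= c.
  have [+ _] := cP x; rewrite /q_star -/(d x) ler_pdivrMl// => H.
  by rewrite -ler_pdivlMr.
have theta_ge x : c^-1 <= theta x * d x.
  have [_ +] := cP x; rewrite /q_star -/(d x) => H.
  by rewrite -(ler_pM2l c0) mulfV ?gt_eqF// mulrA -ler_pdivrMr// mul1r.
have Q_cont : continuous Q.
  exact: (abs_continuous_loc_continuous _ (primitive_abs_continuous _ _ q_loc qQ)).
have expNQ_cont : continuous (fun x => expR (- Q x)).
  by move=> x; apply: continuous_comp; [exact/continuousN/Q_cont|exact: continuous_expR].
have thetaQ_cont : continuous (fun x => theta x * expR (Q x)).
  move=> x; apply: cvgM; first exact: theta_cont.
  by apply: continuous_comp; [exact: Q_cont|exact: continuous_expR].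
have expNQ_loc := continuous_locally_integrable _ expNQ_cont.
have thetaQ_loc := continuous_locally_integrable _ thetaQ_cont.
have thetaQ_ge0 x : 0 <= theta x * expR (Q x) by rewrite mulr_ge0 ?expR_ge0// ltW.
(* [E] and [P] are primitives of the two factors of the Green kernel; their increments are the
   truncated row and column integrals. *)
have [E qE] := primitive_exists _ expNQ_loc.
have [P qP] := primitive_exists _ thetaQ_loc.
have E_homo := primitive_homo _ _ (fun x => expR_ge0 (- Q x)) qE.
have P_homo := primitive_homo _ _ thetaQ_ge0 qP.
have E_le x y : x <= y -> E y - E x <= expR (- Q x) * (y - x).
  move=> xy; apply: primitive_le_linear expNQ_loc qE xy _ => t xt _.
  by rewrite ler_expR lerN2; exact: Q_homo.
have E_ge x y : x <= y -> expR (- Q y) * (y - x) <= E y - E x.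
  move=> xy; apply: primitive_ge_linear expNQ_loc qE xy _ => t _ ty.
  by rewrite ler_expR lerN2; exact: Q_homo.
have P_le M x y : x <= y -> (forall z, x <= z -> z <= y -> theta z <= M) ->
    P y - P x <= expR (Q y) * (M * (y - x)).
  move=> xy thM; rewrite mulrA.
  apply: primitive_le_linear thetaQ_loc qP xy _ => t xt ty.
  rewrite mulrC; apply: ler_pM => //; [exact: ltW| |exact: thM].
  by rewrite ler_expR; exact: Q_homo.
have [C1 C10 C1P] := forward_bound Q d Q_homo Q_unb Q_unbN d_gt0 Q_d d_min
  a b x0 a1 bE K E E_homo E_le x00.
have [C2 C20 C2P] := backward_bound Q d Q_homo Q_unb Q_unbN d_gt0 Q_d d_min
  a b x0 a1 bE K theta P c theta_cont theta_le P_homo P_le x00 (ltW c0).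
have row x : (\int[lebesgue_measure]_(t in `[x, +oo[) (expR (- Q t))%:E <=
    (C1 * (d x * expR (- Q x)))%:E)%E.
  apply: integral_itvy_le => [|t|T xT]; [exact: continuous_measurable_fun|exact: expR_ge0|].
  by rewrite (integral_primitive _ _ _ _ expNQ_loc qE xT) lee_fin C1P.
have col t : (\int[lebesgue_measure]_(x in `]-oo, t]) (theta x * expR (Q x))%:E <=
    (C2 * expR (Q t))%:E)%E.
  apply: integral_itvNy_le => [|x|S St]; [exact: continuous_measurable_fun|exact: thetaQ_ge0|].
  by rewrite (integral_primitive _ _ _ _ thetaQ_loc qP St) lee_fin C2P.
have p0 : 0 < p by lra.
pose B := C1 * (d 0 * expR (- Q 0)) * expR 2.
have B0 : 0 < B by rewrite !mulr_gt0 ?expR_gt0.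
(* [d x exp (- Q x - 2) <= E (x + d x) - E x], which is bounded on [0, oo[ *)
have d_le x : 0 <= x -> d x * expR (- Q x) <= B.
  move=> x_ge0; have dx := d_gt0 x.
  have xdx : x <= x + d x by lra.
  have H1 := E_ge x (x + d x) xdx.
  have H2 : E (x + d x) - E 0 <= C1 * (d 0 * expR (- Q 0)) by apply: C1P; lra.
  have H3 := E_homo _ _ x_ge0.
  have H4 : Q (x + d x) <= Q x + 2.
    by rewrite Q_d lerD2r; apply: Q_homo; lra.
  have H5 : expR (- Q x) <= expR (- Q (x + d x)) * expR 2.
    by rewrite -expRD ler_expR; lra.
  apply: (@le_trans _ _ (d x * (expR (- Q (x + d x)) * expR 2))).
    by rewrite ler_pM2l.
  rewrite mulrA ler_pM2r ?expR_gt0//; move: H1.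
  by rewrite addrAC subrr add0r mulrC; lra.
(* From [c^-1 <= theta * d = (theta * exp Q) * (d * exp (- Q))], the last factor being at most [B]
   on [[0, +oo[]. *)
pose kappa := c^-1 / B.
have kappa0 : 0 < kappa by rewrite divr_gt0 ?invr_gt0.
have kappaP x : 0 <= x -> kappa <= theta x * expR (Q x).
  move=> x_ge0; rewrite ler_pdivrMr//; apply: (le_trans (theta_ge x)).
  rewrite -mulrA ler_pM2l//.
  have -> : d x = expR (Q x) * (d x * expR (- Q x)).
    by rewrite mulrCA -expRD subrr expR0 mulr1.
  by rewrite ler_pM2l ?expR_gt0// d_le.
have fP f : f \in Lfun (@lebesgue_measure R) p%:E -> measurable_fun setT f /\
    (\int[lebesgue_measure]_x (`|f x| `^ p)%:E < +oo)%E.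
  move=> /andP[mf ff]; split; first by move: mf; rewrite inE.
  move: ff; rewrite inE /finite_norm/= unlock; apply: lty_poweRy.
  by rewrite invr_eq0 gt_eqF.
pose y f := green Q f.
have y_sol f : f \in Lfun (@lebesgue_measure R) p%:E -> is_solution q f (y f).
  move=> /fP[mf intf].
  exact: (green_solution q Q d C1 p q_loc qQ Q_homo d_gt0 C10 row p_ge1 f mf intf).
pose A := (C1 * c) `^ (p - 1) * C2.
have A0 : 0 < A by rewrite mulr_gt0// powR_gt0// mulr_gt0.
have y_bound f : f \in Lfun (@lebesgue_measure R) p%:E ->
    (\int[lebesgue_measure]_x (`|theta x * y f x| `^ p)%:E <=
     A%:E * \int[lebesgue_measure]_x (`|f x| `^ p)%:E)%E.
  move=> /fP[mf intf]; exact: (green_bound q Q theta d C1 C2 c p q_loc qQ Q_homo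
    d_gt0 C10 row theta_cont theta_gt0 theta_le C20 col p_ge1 f mf intf).
have y_weighted f : f \in Lfun (@lebesgue_measure R) p%:E -> Lp_weighted p theta (y f).
  move=> Lf; split.
    by apply: continuous_Lp_loc => //; apply: abs_continuous_loc_continuous; exact: (y_sol f Lf).1.
  apply: le_lt_trans (y_bound f Lf) _.
  by rewrite lte_mul_pinfty ?lee_fin ?(ltW A0)//; exact: (fP f Lf).2.
have uniq f y1 y2 := @weighted_solution_unique R q Q q_loc qQ theta p kappa f y1 y2
  p0 theta_cont kappa0 kappaP.
split=> [f Lf|].
  exists (y f); split; first by split; [exact: y_sol|exact: y_weighted].
  by move=> y' [sol' w']; apply: (uniq f) => //; [exact: y_sol|exact: y_weighted].
(* [A] compares integrals of [p]-th powers, so its [p]-th root compares norms; uniqueness identifies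
   any weighted solution with the Green one. *)
exists (A `^ p^-1); first exact: powR_gt0.
move=> f y' Lf sol' w'.
rewrite (uniq f y' (y f) sol' (y_sol f Lf) w' (y_weighted f Lf)).
exact: Lnorm_le_scale p0 (ltW A0) (y_bound f Lf).
Qed.
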